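(* Let $T=-T_{\mathfrak p}Q|_{\mathfrak p}+T_1Q|_{\mathfrak k_1}+\cdots+T_{r+s}Q|_{\mathfrak k_{r+s}}$ be a left-invariant $(0,2)$-tensor field on $G$ with $T_{\mathfrak p},T_1,\dots,T_{r+s}>0$. Consider the conditions $$\text{(A)}\quad \sum_{i=1}^{r+s}\frac{n^2\kappa_iT_{\mathfrak p}^2-d_i^2(1-\kappa_i)T_i^2}{nT_{\mathfrak p}T_i}-2n<0,$$ $$\text{(B)}\quad \frac{\kappa_m\,\mathrm{tr}_QT}{T_m}<\dim\mathfrak k+d_m(1-\kappa_m)-3n,$$ where $m\in\{1,\dots,r\}$ is an index with $\frac{\kappa_m}{T_m}=\max_{i=1,\dots,r}\frac{\kappa_i}{T_i}$. Then: (1) If (A) holds, there exists at least one pair $(g,c)\in\mathcal M_K\times(0,\infty)$ with $\mathrm{Ric}(g)=cT$. (2) If both (A) and (B) hold, there exist at least two pairs $(g,c)\in\mathcal M_K\times(0,\infty)$ with $\mathrm{Ric}(g)=cT$ whose metrics $g$ are not homothetic. (3) Suppose $r+s=2$, and define $a,b,c,d,D,R_t,R_d,R_s$ from $T_{\mathfrak p},T_1,T_2$ by $a=nd_2(1-\kappa_2)T_{\mathfrak p}$, $b=d_1^2(1-\kappa_1)T_1-d_2^2(1-\kappa_2)T_2+2n^2T_{\mathfrak p}-\frac{n^2\kappa_1T_{\mathfrak p}^2}{T_1}$, $c=-2nd_2T_2+\frac{2nd_2\kappa_1T_{\mathfrak p}T_2}{T_1}-nd_2\kappa_2T_{\mathfrak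 p}$, $d=-\frac{d_2^2\kappa_1T_2^2}{T_1}+\kappa_2d_2^2T_2$, $D=18abcd-4b^3d+b^2c^2-4ac^3-27a^2d^2$, $R_t=-\frac b{3a}$, and (when $b^2\ne3ac$) $R_d=\frac{9ad-bc}{2(b^2-3ac)}$, $R_s=\frac{4abc-9a^2d-b^3}{a(b^2-3ac)}$. If one of the following holds: (i) $D=0$, $b^2=3ac$, $\frac{d_2T_2}{nT_{\mathfrak p}}<R_t$; (ii) $D=0$, $b^2\ne3ac$, $R_s\le\frac{d_2T_2}{nT_{\mathfrak p}}<R_d$; (iii) $D=0$, $b^2\ne3ac$, $\frac{d_2T_2}{nT_{\mathfrak p}}<R_s<R_d$; (iv) $D=0$, $b^2\ne3ac$, $\frac{d_2T_2}{nT_{\mathfrak p}}<R_d<R_s$; then there exists at least one pair $(g,c')\in\mathcal M_K\times(0,\infty)$ with $\mathrm{Ric}(g)=c'T$.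
   Context: Let $G$ be a connected non-compact simple Lie group with Lie algebra $\mathfrak g$, $K$ a maximal compact subgroup with Lie algebra $\mathfrak k$, $B$ the Killing form of $\mathfrak g$, and $\mathfrak p$ the $B$-orthogonal complement of $\mathfrak k$ in $\mathfrak g$. Let $Q=B|_{\mathfrak p}-B|_{\mathfrak k}$ (an inner product; $\mathrm{tr}_QT=-nT_{\mathfrak p}+\sum_id_iT_i$). Write $\mathfrak k=\mathfrak k_1\oplus\cdots\oplus\mathfrak k_{r+s}$, where $\mathfrak k_1,\dots,\mathfrak k_r$ are the simple ideals of $[\mathfrak k,\mathfrak k]$, $\mathfrak k_{r+1}$ is the centre of $\mathfrak k$, and $s=1$ if the centre is nontrivial, $s=0$ otherwise. Let $n=\dim\mathfrak p$, $d_i=\dim\mathfrak k_i$, and define $\kappa_i$ by $B_i=\kappa_iB|_{\mathfrak k_i}$, $B_i$ the Killing form of $\mathfrak k_i$. Left-invariant tensor fields on $G$ are identified with bilinear forms on $\mathfrak g$; $Q|_{\mathfrak u}$ denotes $Q$ restricted to $\mathfrak u$ and extended by zero on its $Q$-orthogonal complement. $\mathcal M_K$ is the set of left-invariant metrics on $G$ naturally reductive with respect to $G\times K$ (acting by $(x,k)y=xyk^{-1}$), which by a theorem of Gordon are exactly the metrics $\beta Q|_{\mathfrak p}+\sum_i\alpha_iQ|_{\mathfrak k_i}$ with $\beta,\alpha_i>0$. *)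

(* Defs.v *)
(* real Lie algebras encoded by structure constants on R^N,
   subspaces encoded as row spaces of square matrices (mxalgebra). *)
From HB Require Import structures.
From mathcomp Require Import all_boot all_order all_algebra.
From mathcomp Require Import reals.

Set Implicit Arguments.
Unset Strict Implicit.
Unset Printing Implicit Defensive.

Import Order.TTheory GRing.Theory Num.Theory.
Local Open Scope ring_scope.

Section LieDefs.
Variables (R : realType) (N : nat).
Local Notation vec := 'rV[R]_N.

Definition bracket (c : 'I_N -> 'I_N -> vec) (u v : vec) : vec :=
  \sum_(i < N) \sum_(j < N) (u 0 i * v 0 j) *: c i j.

Definition ev (i : 'I_N) : vec := delta_mx 0 i.

Definition is_lie_algebra (c : 'I_N -> 'I_N -> vec) : Prop :=
  (forall u v, bracket c u v = - bracket c v u) /\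
  (forall u v w, bracket c u (bracket c v w) + bracket c v (bracket c w u)
                 + bracket c w (bracket c u v) = 0).

(* ad X, acting on row vectors on the right: u *m adm c X = [X, u] *)
Definition adm c (X : vec) : 'M[R]_N := lin1_mx (bracket c X).

Definition killing c (X Y : vec) : R := \tr (adm c X *m adm c Y).

Definition gram_of (f : vec -> vec -> R) : 'M[R]_N :=
  \matrix_(i, j) f (ev i) (ev j).

Definition br_sub c (A B C : 'M[R]_N) : Prop :=
  forall x y, (x <= A)%MS -> (y <= B)%MS -> (bracket c x y <= C)%MS.

Definition subalgebra c (V : 'M[R]_N) : Prop := br_sub c V V V.

Definition ideal_of c (I V : 'M[R]_N) : Prop := (I <= V)%MS /\ br_sub c V I I.

Definition simple_lie c (V : 'M[R]_N) : Prop :=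
  subalgebra c V /\
  (exists x y, [/\ (x <= V)%MS, (y <= V)%MS & bracket c x y != 0]) /\
  (forall I : 'M[R]_N, ideal_of c I V -> \rank I = 0%N \/ (I == V)%MS).

Definition derived c (V : 'M[R]_N) : 'M[R]_N :=
  (\sum_(i < N) \sum_(j < N) <<bracket c (row i V) (row j V)>>)%MS.

Definition perp c (k : 'M[R]_N) : 'M[R]_N := kermx (gram_of (killing c) *m k^T).

(* trace of a linear map (matrix F) restricted to an invariant subspace V *)
Definition restr_tr (V F : 'M[R]_N) : R :=
  \tr (row_base V *m F *m pinvmx (row_base V)).

Definition killing_on c (V : 'M[R]_N) (X Y : vec) : R :=
  restr_tr V (adm c X *m adm c Y).

Definition Qform c (k : 'M[R]_N) (x y : vec) : R :=
  let p := perp c k in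
  killing c (x *m proj_mx p k) (y *m proj_mx p k)
  - killing c (x *m proj_mx k p) (y *m proj_mx k p).

(* Q|_U : Q restricted to U, extended by zero on the Q-orthogonal complement *)
Definition Qrestr c k (U : 'M[R]_N) (x y : vec) : R :=
  let P := proj_mx U (kermx (gram_of (Qform c k) *m U^T)) in
  Qform c k (x *m P) (y *m P).

(* the set M_K of left-invariant metrics naturally reductive w.r.t. G x K *)
Definition inMK c k r s (kk : 'I_(r + s) -> 'M[R]_N) (g : vec -> vec -> R) : Prop :=
  exists (beta : R) (alpha : 'I_(r + s) -> R),
    [/\ 0 < beta, (forall i, 0 < alpha i) &
        forall x y, g x y = beta * Qrestr c k (perp c k) x y
                          + \sum_(i < r + s) alpha i * Qrestr c k (kk i) x y].

Definition tensorT c k r s (kk : 'I_(r + s) -> 'M[R]_N) (Tp : R)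
  (Ti : 'I_(r + s) -> R) (x y : vec) : R :=
  - Tp * Qrestr c k (perp c k) x y + \sum_(i < r + s) Ti i * Qrestr c k (kk i) x y.

Definition koszul c (g : vec -> vec -> R) (X Y Z : vec) : R :=
  2%:R^-1 * (g (bracket c X Y) Z - g (bracket c Y Z) X + g (bracket c Z X) Y).

Definition nabla c (g : vec -> vec -> R) (X Y : vec) : vec :=
  (\row_l koszul c g X Y (ev l)) *m invmx (gram_of g).

Definition riem c g (X Y Z : vec) : vec :=
  nabla c g X (nabla c g Y Z) - nabla c g Y (nabla c g X Z)
  - nabla c g (bracket c X Y) Z.

Definition ricci c g (X Y : vec) : R := \tr (lin1_mx (fun Z => riem c g Z X Y)).

Definition homothetic (g1 g2 : vec -> vec -> R) : Prop :=
  exists lam : R, 0 < lam /\ forall x y, g1 x y = lam * g2 x y.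

End LieDefs.

Definition part3_cond (R : realType) (n d1 d2 k1 k2 Tp T1 T2 : R) : Prop :=
  let a := n * d2 * (1 - k2) * Tp in
  let b := d1 ^+ 2 * (1 - k1) * T1 - d2 ^+ 2 * (1 - k2) * T2 + 2%:R * n ^+ 2 * Tp
           - n ^+ 2 * k1 * Tp ^+ 2 / T1 in
  let c := - (2%:R * n * d2 * T2) + 2%:R * n * d2 * k1 * Tp * T2 / T1
           - n * d2 * k2 * Tp in
  let d := - (d2 ^+ 2 * k1 * T2 ^+ 2 / T1) + k2 * d2 ^+ 2 * T2 in
  let D := 18%:R * a * b * c * d - 4%:R * b ^+ 3 * d + b ^+ 2 * c ^+ 2
           - 4%:R * a * c ^+ 3 - 27%:R * a ^+ 2 * d ^+ 2 in
  let Rt := - (b / (3%:R * a)) in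
  let Rd := (9%:R * a * d - b * c) / (2%:R * (b ^+ 2 - 3%:R * a * c)) in
  let Rs := (4%:R * a * b * c - 9%:R * a ^+ 2 * d - b ^+ 3)
            / (a * (b ^+ 2 - 3%:R * a * c)) in
  let x := d2 * T2 / (n * Tp) in
  D = 0 /\
  [\/ b ^+ 2 = 3%:R * a * c /\ x < Rt,
      b ^+ 2 != 3%:R * a * c /\ (Rs <= x /\ x < Rd),
      b ^+ 2 != 3%:R * a * c /\ (x < Rs /\ Rs < Rd) |
      b ^+ 2 != 3%:R * a * c /\ (x < Rd /\ Rd < Rs)].

(* Main.v *)
Require Import Defs.
From HB Require Import structures.
From mathcomp Require Import all_boot all_order all_algebra.
From mathcomp Require Import reals complex.
From mathcomp Require Import classical_sets interval_inference topology normedtype realfun.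
From mathcomp Require Import ring lra.
Set Implicit Arguments.
Unset Strict Implicit.
Unset Printing Implicit Defensive.
Import Order.TTheory GRing.Theory Num.Theory.
Local Open Scope ring_scope.

(* Let P, Pi_i be the B-orthogonal projections onto p and k_i.  For the metric with
   beta = 1 and alpha_i = y_i the Koszul formula gives the Levi-Civita connection in
   closed form, and since tr(Z -> nabla_Z Y) = 0 the Ricci tensor is
     Ric(X, Y) = - tr (nabla_. Y o nabla_. X)
               = - 1/4 sum_i (kappa_i + (1 - kappa_i) y_i^2) B(X_i, Y_i)
                 - 1/2 sum_i (2 + y_i) mu_i B(X_p, Y_p),
   where tr (Pi_i ad u ad v) = mu_i B(u, v) on p by Schur's lemma (an ad(k)-invariant
   subspace E of p generates the ideal E + [E, E]) and n mu_i = d_i (1 - kappa_i).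
   Hence Ric = (C / 4) T amounts to C T_i = kappa_i + (1 - kappa_i) y_i^2 together
   with F(C) := 2 n + 2 sum_i d_i (1 - kappa_i) y_i - n C T_p = 0.
   F is eventually negative.  At a value C where sum_i x_i / y_i = 1, with
   x_i = d_i T_i / (n T_p), one has
     F(C) = 2 n + sum_i d_i ((1 - kappa_i) y_i - kappa_i / y_i),
   which is positive under (A) because y_i >= x_i; under (B), F is negative at
   max_i kappa_i / T_i, which gives a second zero.  In part (3), F(C) has the sign of
   the cubic a t^3 + b t^2 + c t + d at t = y_2 > x_2; the cubic is positive at x_2, so
   only case (ii) can occur, where it equals a (t - R_s) (t - R_d)^2 >= 0. *)

(** Rescaling a metric leaves its Ricci tensor unchanged, so fixing beta = 1 loses nothing. The
    special value of C comes from calculus: where y_i > 0 one has y_i' = T_i / (2 (1 - kappa_i)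
    y_i), hence F'(C) = n T_p (sum_i x_i / y_i - 1). As F is concave on C >= max_i kappa_i / T_i,
    the point with sum_i x_i / y_i = 1 is its maximum. Condition (A) bounds this maximum from below
    by a positive number, and (B) makes F negative at the left end of the interval. The proof itself
    takes no derivative. Two facts taken for granted in this picture need work. The hypotheses only
    list the simple ideals of [k, k] and the centre of k; that these are orthogonal and add up to k
    is derived from the definiteness of B on k. And the division by 1 - kappa_i needs kappa_i < 1,
    which comes from the simplicity of g: kappa_i = 1 would make k_i commute with p. *)

Section BilinearForms.
Context {R : realType}.

(** * Matrices as bilinear forms: definiteness, orthogonal projections, traces *)

Definition mxform n (M : 'M[R]_n) (x y : 'rV[R]_n) : R := (x *m M *m y^T) 0 0.

Lemma mxformDl n (M : 'M[R]_n) x x' y :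
  mxform M (x + x') y = mxform M x y + mxform M x' y.
Proof. by rewrite /mxform !mulmxDl mxE. Qed.

Lemma mxformDr n (M : 'M[R]_n) x y y' :
  mxform M x (y + y') = mxform M x y + mxform M x y'.
Proof. by rewrite /mxform linearD mulmxDr mxE. Qed.

Lemma mxformZl n (M : 'M[R]_n) a x y : mxform M (a *: x) y = a * mxform M x y.
Proof. by rewrite /mxform -!scalemxAl mxE. Qed.

Lemma mxformZr n (M : 'M[R]_n) a x y : mxform M x (a *: y) = a * mxform M x y.
Proof. by rewrite /mxform linearZ -!scalemxAr mxE. Qed.

Lemma mxformNl n (M : 'M[R]_n) x y : mxform M (- x) y = - mxform M x y.
Proof. by rewrite -scaleN1r mxformZl mulN1r. Qed.

Lemma mxformNr n (M : 'M[R]_n) x y : mxform M x (- y) = - mxform M x y.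
Proof. by rewrite -scaleN1r mxformZr mulN1r. Qed.

Lemma mxform0l n (M : 'M[R]_n) y : mxform M 0 y = 0.
Proof. by rewrite -(scale0r 0) mxformZl mul0r. Qed.

Lemma mxform0r n (M : 'M[R]_n) y : mxform M y 0 = 0.
Proof. by rewrite -(scale0r 0) mxformZr mul0r. Qed.

Lemma mxform_suml n (M : 'M[R]_n) I r (P : pred I) (F : I -> 'rV[R]_n) y :
  mxform M (\sum_(i <- r | P i) F i) y = \sum_(i <- r | P i) mxform M (F i) y.
Proof.
by elim/big_rec2: _ => [|i a b _ <-]; rewrite ?mxform0l // mxformDl.
Qed.

Lemma mxform_sumr n (M : 'M[R]_n) I r (P : pred I) (F : I -> 'rV[R]_n) x :
  mxform M x (\sum_(i <- r | P i) F i) = \sum_(i <- r | P i) mxform M x (F i).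
Proof.
by elim/big_rec2: _ => [|i a b _ <-]; rewrite ?mxform0r // mxformDr.
Qed.

Lemma mxform_ev n (M : 'M[R]_n) i j : mxform M (ev R i) (ev R j) = M i j.
Proof.
by rewrite /mxform /ev -rowE trmx_delta -colE !mxE.
Qed.

Lemma eq_mxform n (M M' : 'M[R]_n) : mxform M =2 mxform M' -> M = M'.
Proof. by move=> e; apply/matrixP=> i j; rewrite -!mxform_ev e. Qed.

Lemma mxformC n (M : 'M[R]_n) x y : M^T = M -> mxform M x y = mxform M y x.
Proof.
move=> e; rewrite /mxform -{1}e -[_ *m y^T]trmxK mxE.
by rewrite !trmx_mul !trmxK mulmxA.
Qed.

Definition posdefmx n (H : 'M[R]_n) :=
  H^T = H /\ forall x : 'rV_n, x != 0 -> 0 < mxform H x x.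

Lemma row_neq0 m n (M : 'M[R]_(m, n)) : M != 0 -> exists i, row i M != 0.
Proof.
move=> M0; apply/existsP; apply: contraNT M0; rewrite negb_exists => /forallP h.
by apply/eqP/row_matrixP => i; rewrite row0; apply/eqP/negPn/h.
Qed.

(** Induction on the Schur complement of the top left entry. It is the form restricted to the
    [H]-orthogonal of the first basis vector, hence again positive definite; the vector [y] below is
    the lift of [x] to that orthogonal. *)
Lemma cholesky n (H : 'M[R]_n) :
  posdefmx H -> exists2 E : 'M_n, E \in unitmx & H = E *m E^T.
Proof.
elim: n H => [|n IHn] H [Hs Hp].
  exists 1%:M; first exact: unitmx1.
  by rewrite [H]flatmx0 [RHS]flatmx0.
rewrite -[n.+1]/(1 + n)%N in H Hs Hp *.
set h := H 0 0.
have h0 : 0 < h.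
  have := Hp (delta_mx 0 0); rewrite -[delta_mx _ _]/(ev R 0) mxform_ev; apply.
  apply/eqP => /matrixP/(_ 0 0)/eqP.
  by rewrite !mxE eqxx oner_eq0.
set b := ursubmx H.
have Hb : dlsubmx H = b^T by rewrite /b trmx_ursub Hs.
have Hul : ulsubmx H = h%:M.
  by apply/matrixP=> i j; rewrite !ord1 !mxE /h; congr (H _ _); apply/val_inj.
have HE : H = block_mx h%:M b b^T (drsubmx H).
  by rewrite -[LHS]submxK Hul Hb.
pose S := drsubmx H - h^-1 *: (b^T *m b).
have [|E uE ES] := IHn S; first split.
- by rewrite /S linearB linearZ /= trmx_mul trmxK trmx_drsub Hs.
- move=> x x0.
  pose y := row_mx (- h^-1 *: (x *m b^T)) x.
  have y0 : y != 0.
    by apply: contraNneq x0 => /(congr1 rsubmx); rewrite row_mxKr linear0 => ->.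
  have := Hp y y0; rewrite /mxform {1}HE.
  rewrite /y mul_row_block tr_row_mx mul_row_col.
  rewrite mul_mx_scalar scalerA mulrN divff ?gt_eqF // scaleN1r addNr mul0mx add0r.
  by rewrite /S mulmxBr -scalemxAr -!scalemxAl !mulmxA addrC scaleNr.
exists (block_mx (Num.sqrt h)%:M 0 ((Num.sqrt h)^-1 *: b^T) E).
  by rewrite unitmxE det_lblock det_scalar expr1 unitrM -unitmxE uE andbT
    unitfE gt_eqF ?sqrtr_gt0.
rewrite tr_block_mx mulmx_block -ES HE !(trmx0, mulmx0, mul0mx, addr0, add0r).
have s0 : Num.sqrt h != 0 by rewrite gt_eqF ?sqrtr_gt0.
rewrite tr_scalar_mx -scalar_mxM -expr2 sqr_sqrtr ?ltW //.
rewrite linearZ /= trmxK -scalemxAr mul_scalar_mx scalerA mulVf // scale1r.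
rewrite mul_mx_scalar scalerA divff // scale1r -scalemxAl -scalemxAr scalerA.
by rewrite -invfM -expr2 sqr_sqrtr ?ltW // addrC /S subrK.
Qed.

(** Conjugation by the Cholesky factor turns an [H]-skew matrix into an antisymmetric one, the trace
    of whose square is minus the sum of its squared entries. *)
Lemma mxtrace_sqr_skew n (H A : 'M[R]_n) : posdefmx H -> A *m H = - (H *m A^T) ->
  \tr (A *m A) <= 0 /\ (\tr (A *m A) = 0 -> A = 0).
Proof.
move=> /cholesky [E uE ->] skewA.
pose A' := invmx E *m A *m E.
have A'E : A = E *m A' *m invmx E.
  by rewrite /A' !mulmxA mulmxV // mul1mx mulmxK.
have uET : E^T \in unitmx by rewrite unitmx_tr.
have A'skew : A'^T = - A'.
  have e : A' = invmx E *m (A *m (E *m E^T)) *m invmx (E^T).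
    by rewrite /A' !mulmxA mulmxK.
  rewrite {1}e skewA mulmxN mulNmx !mulmxA mulVmx // mul1mx linearN /=.
  by rewrite !trmx_mul !trmxK trmx_inv trmxK !mulmxA.
have -> : \tr (A *m A) = - \sum_i \sum_j A' i j ^+ 2.
  have -> : \tr (A *m A) = \tr (A' *m A').
    have -> : A *m A = E *m (A' *m A' *m invmx E).
      by rewrite A'E !mulmxA mulmxKV.
    by rewrite mxtrace_mulC mulmxKV.
  have -> : A' *m A' = - (A'^T *m A') by rewrite A'skew mulNmx opprK.
  rewrite linearN /=; congr (- _).
  rewrite exchange_big; apply: eq_bigr => i _; rewrite mxE.
  by apply: eq_bigr => j _; rewrite mxE expr2.
split; first by rewrite oppr_le0; do 2 apply: sumr_ge0 => ? _; apply: sqr_ge0.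
move/eqP; rewrite oppr_eq0 => /eqP /psumr_eq0P h.
suff A'0 : A' = 0 by rewrite A'E A'0 mulmx0 mul0mx.
apply/matrixP=> i j; rewrite [RHS]mxE; apply/eqP; rewrite -sqrf_eq0; apply/eqP.
have hi : \sum_j A' i j ^+ 2 = 0.
  by apply: h => // l _; apply: sumr_ge0 => ? _; apply: sqr_ge0.
by apply: (psumr_eq0P _ hi) => // ? _; apply: sqr_ge0.
Qed.

(* For a complex eigenvalue [a + ib] with eigenvector [u + iv], symmetry of
   [A] gives [b (|u|^2 + |v|^2) = 0]. *)
Lemma real_eigenvalue n (A H : 'M[R]_n) : (0 < n)%N -> posdefmx H ->
  A *m H = H *m A^T -> exists a, eigenvalue A a.
Proof.
move=> n0 [Hs Hp] AH.
have [l /eigenvalueP [w wA w0]] := eigenvalue_closed (map_mx (real_complex R) A) n0.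
pose u := map_mx (@complex.Re R) w; pose v := map_mx (@complex.Im R) w.
pose a := complex.Re l; pose b := complex.Im l.
have wE i : w 0 i = (u 0 i +i* v 0 i)%C by rewrite !mxE; case: (w 0 i).
have [uA vA] : u *m A = a *: u - b *: v /\ v *m A = b *: u + a *: v.
  have e j : \sum_i w 0 i * (A i j)%:C%C = l * w 0 j.
    move/matrixP/(_ 0 j): wA; rewrite !mxE => <-.
    by apply: eq_bigr => i _; rewrite !mxE.
  split; apply/matrixP=> i j; rewrite !ord1.
    move/(congr1 (@complex.Re R)): (e j); rewrite raddf_sum /= => ej.
    rewrite mxE (eq_bigr (fun i => complex.Re (w 0 i * (A i j)%:C%C))).
      by rewrite ej wE /a /b !mxE; case: (l).
    by move=> m _; rewrite wE /= mulr0 subr0.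
  move/(congr1 (@complex.Im R)): (e j); rewrite raddf_sum /= => ej.
  rewrite mxE (eq_bigr (fun i => complex.Im (w 0 i * (A i j)%:C%C))).
    by rewrite ej wE /a /b !mxE; case: (l) => ? ? /=; rewrite addrC.
  by move=> m _; rewrite wE /= mulr0 add0r.
have AHf x y : mxform H (x *m A) y = mxform H x (y *m A).
  by rewrite /mxform trmx_mul -!mulmxA (mulmxA A) AH !mulmxA.
have pos x : 0 <= mxform H x x.
  by have [->|/Hp/ltW//] := eqVneq x 0; rewrite mxform0l.
have key : b * (mxform H u u + mxform H v v) = 0.
  have := AHf u v; rewrite uA vA.
  rewrite !(mxformDl, mxformDr, mxformNl, mxformZl, mxformZr).
  by move=> h; lra.
have uv0 : (u != 0) || (v != 0).
  rewrite -negb_and; apply: contra w0 => /andP [/eqP u0 /eqP v0].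
  by apply/eqP/matrixP => i j; rewrite ord1 wE u0 v0 !mxE.
have b0 : b = 0.
  move/eqP: key; rewrite mulf_eq0 => /orP [/eqP //|].
  by rewrite paddr_eq0 // => /andP [/eqP hu /eqP hv]; case/orP: uv0 => /Hp;
    rewrite ?hu ?hv ltxx.
exists a; apply/eigenvalueP.
by case/orP: uv0 => x0; [exists u | exists v] => //;
  rewrite ?uA ?vA b0 scale0r ?subr0 ?add0r.
Qed.

Lemma kermx_formP n (M U : 'M[R]_n) (x : 'rV_n) :
  reflect (forall y, (y <= U)%MS -> mxform M x y = 0)
          (x <= kermx (M *m U^T))%MS.
Proof.
rewrite sub_kermx mulmxA; apply: (iffP eqP) => [h y /submxP [D ->]|h].
  by rewrite /mxform trmx_mul mulmxA h mul0mx mxE.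
apply/matrixP=> i j; rewrite ord1 [RHS]mxE -(h (row j U) (row_sub _ _)).
by rewrite /mxform tr_row !mxE; apply: eq_bigr => l _; rewrite !mxE.
Qed.

(** The third clause is self-adjointness for the form [M]; it characterises the orthogonal
    projection without choosing a complement. *)
Definition orthprojmx n (M U P : 'M[R]_n) :=
  [/\ (P <= U)%MS, U *m P = U & P *m M = M *m P^T].

(** Weaker than definiteness and without a sign, so that it covers B on subspaces of k, where it is
    negative, and on subspaces of p, where it is positive. *)
Definition anisotropic n (M U : 'M[R]_n) :=
  forall x : 'rV_n, (x <= U)%MS -> mxform M x x = 0 -> x = 0.

Lemma anisotropic_cap n (M U : 'M[R]_n) :
  anisotropic M U -> (U :&: kermx (M *m U^T))%MS = 0.
Proof.
move=> aU; apply/eqP/rowV0P => x; rewrite sub_capmx => /andP [xU /kermx_formP h].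
exact/aU/h.
Qed.

(** Replaces the [proj_mx] built into [Qform] and [Qrestr] by a projection with usable algebra. *)
Lemma orthprojmx_proj n (M U P : 'M[R]_n) : anisotropic M U ->
  orthprojmx M U P -> proj_mx U (kermx (M *m U^T)) = P.
Proof.
move=> aU [PU UP adjP]; have cap0 := anisotropic_cap aU.
have subP : (1%:M - P <= kermx (M *m U^T))%MS.
  apply/sub_kermxP; rewrite mulmxBl mul1mx mulmxA adjP -mulmxA.
  by rewrite -trmx_mul UP subrr.
rewrite -[LHS]mul1mx -{1}[1%:M](subrK P) mulmxDl.
by rewrite proj_mx_0 // proj_mx_id // add0r.
Qed.

Lemma orthprojmx_exists n (M U : 'M[R]_n) : M^T = M -> anisotropic M U ->
  exists P, orthprojmx M U P.
Proof.
move=> sM aU; have cap0 := anisotropic_cap aU.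
set W := kermx (M *m U^T) in cap0; exists (proj_mx U W).
(* Dimension count: [W] is cut out by at most [\rank U] equations and meets [U] trivially. *)
have full : (1%:M <= U + W)%MS.
  rewrite sub1mx /row_full eqn_leq rank_leq_col mxrank_disjoint_sum //.
  rewrite mxrank_ker -leq_subLR leq_sub2l //.
  by rewrite (leq_trans (mxrankM_maxr _ _)) // mxrank_tr.
have dec (x : 'rV_n) : x = x *m proj_mx U W + x *m proj_mx W U.
  by rewrite add_proj_mx // (submx_trans (submx1 x)).
split; [by rewrite -[X in (X <= _)%MS]mul1mx proj_mx_sub|by rewrite proj_mx_id|].
have orth (x y : 'rV_n) : mxform M (x *m proj_mx W U) (y *m proj_mx U W) = 0.
  have /kermx_formP h := proj_mx_sub W U x; apply: h.
  exact: proj_mx_sub.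
apply: eq_mxform => x y.
have -> : mxform (proj_mx U W *m M) x y = mxform M (x *m proj_mx U W) y.
  by rewrite /mxform !mulmxA.
have -> : mxform (M *m (proj_mx U W)^T) x y = mxform M x (y *m proj_mx U W).
  by rewrite /mxform (trmx_mul y) !mulmxA.
rewrite {1}(dec y) mxformDr [X in _ + X]mxformC // orth addr0.
by rewrite [in RHS](dec x) mxformDl orth addr0.
Qed.

Lemma orthprojmx_id n (M U P : 'M[R]_n) m (x : 'M_(m, n)) :
  orthprojmx M U P -> (x <= U)%MS -> x *m P = x.
Proof. by move=> [_ UP _] /submxP [D ->]; rewrite -mulmxA UP. Qed.

Lemma orthprojmx_sub n (M U P : 'M[R]_n) m (x : 'M_(m, n)) :
  orthprojmx M U P -> (x *m P <= U)%MS.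
Proof. by move=> [PU _ _]; rewrite mulmx_sub. Qed.

Lemma orthprojmx_adj n (M U P : 'M[R]_n) x y :
  orthprojmx M U P -> mxform M (x *m P) y = mxform M x (y *m P).
Proof.
by move=> [_ _ e]; rewrite /mxform trmx_mul -(mulmxA x) e !mulmxA.
Qed.

(** A projection factors through a basis of its image; cyclicity of the trace then turns traces on
    the subspace into traces of full matrices. *)
Lemma row_base_factor n (U P : 'M[R]_n) : (P <= U)%MS -> U *m P = U ->
  exists2 D, P = D *m row_base U & row_base U *m D = 1%:M.
Proof.
move=> PU UP; have /submxP [D PD] : (P <= row_base U)%MS by rewrite eq_row_base.
exists D => //.
apply: (row_free_inj (row_base_free U)); rewrite /= mul1mx -mulmxA -PD.
have /submxP [E ->] : (row_base U <= U)%MS by rewrite eq_row_base.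
by rewrite -mulmxA UP.
Qed.

Lemma restr_tr_proj n (V F P : 'M[R]_n) : (P <= V)%MS -> V *m P = V ->
  (V *m F <= V)%MS -> restr_tr V F = \tr (P *m F).
Proof.
move=> PV VP VF; have [D -> bD] := row_base_factor PV VP.
rewrite /restr_tr; set b := row_base V in D bD *.
have bF : (b *m F <= b)%MS.
  have /submxP [E Eb] : (b <= V)%MS by rewrite eq_row_base.
  by rewrite {1}Eb -mulmxA eq_row_base mulmx_sub.
rewrite -[in RHS]mulmxA [RHS]mxtrace_mulC -[in RHS](mulmxKpV bF).
by rewrite -(mulmxA _ b D) bD mulmx1.
Qed.

Lemma tr_proj n (U P : 'M[R]_n) : (P <= U)%MS -> U *m P = U ->
  \tr P = (\rank U)%:R.
Proof.
move=> PU UP; have [D -> bD] := row_base_factor PU UP.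
by rewrite mxtrace_mulC bD mxtrace1.
Qed.

End BilinearForms.

(** * The Lie algebra in coordinates: adjoint matrices and the invariance of the Killing form *)

Section Bracket.
Context {R : realType} {N : nat}.
Implicit Types c : 'I_N -> 'I_N -> 'rV[R]_N.
Implicit Types u v w x y z : 'rV[R]_N.

Lemma bracketDl c u u' v :
  bracket c (u + u') v = bracket c u v + bracket c u' v.
Proof.
rewrite -big_split; apply: eq_bigr => i _; rewrite -big_split.
by apply: eq_bigr => j _; rewrite mxE mulrDl scalerDl.
Qed.

Lemma bracketDr c u v v' :
  bracket c u (v + v') = bracket c u v + bracket c u v'.
Proof.
rewrite -big_split; apply: eq_bigr => i _; rewrite -big_split.
by apply: eq_bigr => j _; rewrite mxE mulrDr scalerDl.
Qed.

Lemma bracketZl c a u v : bracket c (a *: u) v = a *: bracket c u v.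
Proof.
rewrite scaler_sumr; apply: eq_bigr => i _; rewrite scaler_sumr.
by apply: eq_bigr => j _; rewrite mxE scalerA mulrA.
Qed.

Lemma bracketZr c a u v : bracket c u (a *: v) = a *: bracket c u v.
Proof.
rewrite scaler_sumr; apply: eq_bigr => i _; rewrite scaler_sumr.
by apply: eq_bigr => j _; rewrite mxE scalerA mulrCA.
Qed.

Fact bracket_is_linear c u : linear (bracket c u).
Proof. by move=> a v w; rewrite bracketDr bracketZr. Qed.
HB.instance Definition _ c u :=
  GRing.isLinear.Build R 'rV[R]_N 'rV[R]_N *:%R (bracket c u) (bracket_is_linear c u).

Lemma mul_adm c u v : v *m adm c u = bracket c u v.
Proof. exact: mul_rV_lin1. Qed.

Fact adm_is_linear c : linear (adm c).
Proof.
move=> a u v; apply/row_matrixP => i; rewrite !rowE mulmxDr -scalemxAr !mul_adm.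
by rewrite bracketDl bracketZl.
Qed.
HB.instance Definition _ c :=
  GRing.isLinear.Build R 'rV[R]_N 'M[R]_N *:%R (adm c) (adm_is_linear c).

Lemma bracket0l c v : bracket c 0 v = 0.
Proof. by rewrite -!mul_adm linear0 /= mulmx0. Qed.

Lemma bracket_suml c I r (P : pred I) (F : I -> 'rV[R]_N) v :
  bracket c (\sum_(i <- r | P i) F i) v = \sum_(i <- r | P i) bracket c (F i) v.
Proof.
by rewrite -mul_adm linear_sum mulmx_sumr; apply: eq_bigr => i _; rewrite mul_adm.
Qed.

Definition kgram c := gram_of (killing c).

Lemma rowE_ev u : u = \sum_i u 0 i *: ev R i.
Proof. exact: row_sum_delta. Qed.

Lemma killingE c x y : killing c x y = mxform (kgram c) x y.
Proof.
rewrite {2}(rowE_ev x) {2}(rowE_ev y) mxform_suml {1}(rowE_ev x) /killing.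
rewrite linear_sum /= mulmx_suml linear_sum /=; apply: eq_bigr => i _.
rewrite linearZ /= -scalemxAl linearZ /= mxformZl mxform_sumr; congr (_ * _).
rewrite {1}(rowE_ev y) linear_sum /= mulmx_sumr linear_sum /=.
apply: eq_bigr => j _; rewrite linearZ /= -scalemxAr linearZ /= mxformZr.
by rewrite mxform_ev mxE.
Qed.

Lemma kgram_sym c : (kgram c)^T = kgram c.
Proof. by apply/matrixP => i j; rewrite !mxE /killing mxtrace_mulC. Qed.

Section Lie.
Variable c : 'I_N -> 'I_N -> 'rV[R]_N.
Hypothesis lie_c : is_lie_algebra c.
Local Notation "[[ u , v ]]" := (bracket c u v) (format "[[ u ,  v ]]").
Local Notation ad := (adm c).
Local Notation G := (kgram c).
Local Notation B := (mxform G).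

Lemma bracketC u v : [[u, v]] = - [[v, u]].
Proof. by case: lie_c => h _; rewrite h. Qed.

Lemma jacobi u v w : [[u, [[v, w]]]] = [[[[u, v]], w]] + [[v, [[u, w]]]].
Proof.
have [_ /(_ u v w) h] := lie_c.
rewrite (bracketC [[u, v]]) (bracketC u w) -!mul_adm mulNmx !mul_adm -opprD.
apply/eqP; rewrite -addr_eq0 -{2}(opprK [[u, [[v, w]]]]) in h *.
by rewrite opprK addrA addrAC; apply/eqP.
Qed.

(** Matrices act on row vectors from the right, which reverses the usual order of the commutator. *)
Lemma adm_bracket u v : ad [[u, v]] = ad v *m ad u - ad u *m ad v.
Proof.
apply/row_matrixP => i; rewrite !rowE mulmxBr !mulmxA !mul_adm (jacobi u v).
by rewrite addrK.
Qed.

Lemma killing_inv u v w : B [[u, v]] w = B u [[v, w]].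
Proof.
rewrite -!killingE /killing !adm_bracket mulmxBl mulmxBr !linearB /=.
rewrite -!mulmxA; congr (_ - _).
by rewrite mxtrace_mulC -!mulmxA.
Qed.

Lemma killing_adm u x y : B (x *m ad u) y = - B x (y *m ad u).
Proof. by rewrite !mul_adm bracketC mxformNl killing_inv. Qed.

Lemma adm_skew u : ad u *m G = - (G *m (ad u)^T).
Proof.
apply: eq_mxform => x y; transitivity (B (x *m ad u) y).
  by rewrite /mxform !mulmxA.
rewrite killing_adm /mxform mulmxN mulNmx [in RHS]mxE.
by rewrite (trmx_mul y) !mulmxA.
Qed.

End Lie.
End Bracket.

(* Row vectors: [x *m P] and [x *m Pi i] are the components of [x] in p and k_i. *)
Record cartan_split (R : realType) (N q : nat) (c : 'I_N -> 'I_N -> 'rV[R]_N)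
    (P : 'M[R]_N) (Pi : 'I_q -> 'M[R]_N) : Prop := CartanSplit {
  cs_one : P + \sum_i Pi i = 1%:M;
  cs_idem : forall i, Pi i *m Pi i = Pi i;
  cs_orth : forall i j, i != j -> Pi i *m Pi j = 0;
  cs_PPi : forall i, P *m Pi i = 0;
  cs_PiP : forall i, Pi i *m P = 0;
  cs_adj : forall i, Pi i *m kgram c = kgram c *m (Pi i)^T;
  cs_bkk0 : forall i j x y, i != j -> bracket c (x *m Pi i) (y *m Pi j) = 0;
  cs_bkk : forall i x y, bracket c (x *m Pi i) (y *m Pi i) *m Pi i
                         = bracket c (x *m Pi i) (y *m Pi i);
  cs_bkp : forall i x y, bracket c (x *m Pi i) (y *m P) *m P
                         = bracket c (x *m Pi i) (y *m P);
  cs_bpp : forall x y, bracket c (x *m P) (y *m P) *m P = 0;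
  cs_pos : forall x, x *m P != 0 -> 0 < mxform (kgram c) (x *m P) (x *m P);
  cs_neg : forall i x, x *m Pi i != 0 ->
    mxform (kgram c) (x *m Pi i) (x *m Pi i) < 0 }.

(** * The projections onto p and the k_i, and how they interact with ad *)

Section Ricci.
Context {R : realType} {N q : nat} (c : 'I_N -> 'I_N -> 'rV[R]_N).
Hypothesis lie_c : is_lie_algebra c.
Variables (P : 'M[R]_N) (Pi : 'I_q -> 'M[R]_N).
Hypothesis CS : cartan_split c P Pi.
Local Notation "[[ u , v ]]" := (bracket c u v) (format "[[ u ,  v ]]").
Local Notation ad := (adm c).
Local Notation G := (kgram c).
Local Notation B := (mxform G).
Implicit Types u v w x y z X Y Z : 'rV[R]_N.

Definition kproj : 'M[R]_N := \sum_i Pi i.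
Local Notation Pk := kproj.

Definition wproj (a : 'I_q -> R) : 'M[R]_N := \sum_i a i *: Pi i.

Lemma cs_PE : P = 1%:M - Pk.
Proof. by rewrite -(cs_one CS) addrK. Qed.

Lemma wprojM a b : wproj a *m wproj b = wproj (fun i => a i * b i).
Proof.
rewrite mulmx_suml; apply: eq_bigr => i _; rewrite mulmx_sumr (bigD1 i) //=.
rewrite big1 ?addr0 => [|j ji].
  by rewrite -scalemxAl -scalemxAr (cs_idem CS) scalerA.
by rewrite -scalemxAl -scalemxAr (cs_orth CS) ?scaler0 // eq_sym.
Qed.

Lemma kprojE : Pk = wproj (fun=> 1).
Proof. by apply: eq_bigr => i _; rewrite scale1r. Qed.

Lemma eq_wproj a b : a =1 b -> wproj a = wproj b.
Proof. by move=> e; apply: eq_bigr => i _; rewrite e. Qed.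

Lemma kproj_wproj a : Pk *m wproj a = wproj a.
Proof. by rewrite kprojE wprojM; apply: eq_wproj => i; rewrite mul1r. Qed.

Lemma wproj_kproj a : wproj a *m Pk = wproj a.
Proof. by rewrite kprojE wprojM; apply: eq_wproj => i; rewrite mulr1. Qed.

Lemma kproj_idem : Pk *m Pk = Pk.
Proof. by rewrite {2 3}kprojE kproj_wproj. Qed.

Lemma P_wproj a : P *m wproj a = 0.
Proof.
rewrite mulmx_sumr big1 // => i _.
by rewrite -scalemxAr (cs_PPi CS) scaler0.
Qed.

Lemma wproj_P a : wproj a *m P = 0.
Proof.
rewrite mulmx_suml big1 // => i _.
by rewrite -scalemxAl (cs_PiP CS) scaler0.
Qed.

Lemma P_kproj : P *m Pk = 0. Proof. by rewrite kprojE P_wproj. Qed.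
Lemma kproj_P : Pk *m P = 0. Proof. by rewrite kprojE wproj_P. Qed.

Lemma P_idem : P *m P = P.
Proof. by rewrite {2}cs_PE mulmxBr mulmx1 P_kproj subr0. Qed.

Lemma wproj_adj a : wproj a *m G = G *m (wproj a)^T.
Proof.
rewrite mulmx_suml linear_sum mulmx_sumr; apply: eq_bigr => i _.
by rewrite linearZ /= -scalemxAl -scalemxAr (cs_adj CS).
Qed.

Lemma kproj_adj : Pk *m G = G *m Pk^T.
Proof. by rewrite kprojE wproj_adj. Qed.

Lemma P_adj : P *m G = G *m P^T.
Proof. by rewrite cs_PE linearB /= mulmxBl mulmxBr mul1mx trmx1 mulmx1 kproj_adj. Qed.

Lemma adjoint_form M x y : M *m G = G *m M^T -> B (x *m M) y = B x (y *m M).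
Proof. by move=> e; rewrite /mxform trmx_mul -(mulmxA x) e !mulmxA. Qed.

Lemma decomp x : x = x *m P + x *m Pk.
Proof. by rewrite -mulmxDr (cs_one CS) mulmx1. Qed.

Lemma decomp_sum x : x = x *m P + \sum_i x *m Pi i.
Proof. by rewrite -mulmx_sumr -mulmxDr (cs_one CS) mulmx1. Qed.

Lemma PiE i : Pi i = wproj (fun j => (j == i)%:R).
Proof.
rewrite /wproj (bigD1 i) //= eqxx scale1r big1 ?addr0 // => j /negbTE ->.
by rewrite scale0r.
Qed.

Lemma kproj_Pi i : Pk *m Pi i = Pi i.
Proof. by rewrite PiE kproj_wproj. Qed.

Lemma Pi_kproj i : Pi i *m Pk = Pi i.
Proof. by rewrite PiE wproj_kproj. Qed.

Lemma wproj_Pi a i : wproj a *m Pi i = a i *: Pi i.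
Proof.
rewrite {1}PiE wprojM /wproj (bigD1 i) //= eqxx mulr1 big1 ?addr0 // => j /negbTE ->.
by rewrite mulr0 scale0r.
Qed.

Lemma Pi_wproj a i : Pi i *m wproj a = a i *: Pi i.
Proof.
by rewrite -wproj_Pi PiE !wprojM; apply: eq_wproj => j; rewrite mulrC.
Qed.

(** A vector in the radical has B(x_p, x_p) = B(x, x_p) = 0, and likewise for every k_i, so
    definiteness on the summands kills all its components. *)
Lemma kgram_unit : G \in unitmx.
Proof.
rewrite -row_free_unit -kermx_eq0; apply/rowV0P => x /sub_kermxP xG.
have Bx y : B x y = 0 by rewrite /mxform xG mul0mx mxE.
have xP : x *m P = 0.
  apply/eqP/negPn/negP => /(cs_pos CS); rewrite adjoint_form ?P_adj //.
  by rewrite Bx ltxx.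
have xPi i : x *m Pi i = 0.
  apply/eqP/negPn/negP => /(cs_neg CS); rewrite adjoint_form ?(cs_adj CS) //.
  by rewrite Bx ltxx.
by rewrite (decomp_sum x) xP big1 ?addr0 // => i _; rewrite xPi.
Qed.

Lemma adj_trmx M : M *m G = G *m M^T -> M^T = invmx G *m M *m G.
Proof. by move=> e; rewrite -mulmxA e mulKmx // kgram_unit. Qed.

Lemma adm_trmx u : (ad u)^T = - (invmx G *m ad u *m G).
Proof.
by rewrite -mulmxA (adm_skew lie_c) mulmxN opprK mulKmx // kgram_unit.
Qed.

Lemma tr_conj_kgram (M : 'M[R]_N) : \tr (invmx G *m M *m G) = \tr M.
Proof. by rewrite mxtrace_mulC mulmxA mulmxV ?kgram_unit // mul1mx. Qed.

(** Passing to the B-adjoint preserves the trace, fixes [M] and changes the sign of [ad u], so the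
    trace equals its own opposite. *)
Lemma tr_adj_adm M u : M *m G = G *m M^T -> \tr (M *m ad u) = 0.
Proof.
move=> e; have : \tr (M *m ad u) = - \tr (M *m ad u); last by move=> ?; lra.
rewrite -{1}mxtrace_tr trmx_mul adm_trmx (adj_trmx e) mulNmx linearN /=.
rewrite !mulmxA mulmxK ?kgram_unit // -(mulmxA _ _ M) tr_conj_kgram.
by rewrite mxtrace_mulC.
Qed.

Lemma tr_adj_adm2 M u v : M *m G = G *m M^T ->
  \tr (M *m ad u *m ad v) = \tr (M *m ad v *m ad u).
Proof.
move=> e; rewrite -[LHS]mxtrace_tr !trmx_mul !adm_trmx (adj_trmx e).
rewrite !(mulNmx, mulmxN) opprK !mulmxA !mulmxK ?kgram_unit //.
rewrite -(mulmxA (invmx G) (ad v)) -(mulmxA (invmx G) _ M) tr_conj_kgram.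
by rewrite mxtrace_mulC mulmxA.
Qed.

(** Each k_j preserves itself, annihilates the other k_i and maps p into p, so ad of k is block
    diagonal. *)
Lemma Pi_adm i u : Pi i *m ad (u *m Pk) = ad (u *m Pk) *m Pi i.
Proof.
have PiC j : Pi i *m ad (u *m Pi j) = ad (u *m Pi j) *m Pi i.
  apply/row_matrixP => l; rewrite !rowE; set x := delta_mx _ _.
  rewrite !mulmxA !mul_adm [in RHS](decomp_sum x) linearD linear_sum /=.
  rewrite mulmxDl -(cs_bkp CS) -(mulmxA _ P) (cs_PPi CS) mulmx0 add0r.
  rewrite (bigD1 j) //= big1 => [|k kj]; last by rewrite (cs_bkk0 CS) // eq_sym.
  rewrite addr0 -(cs_bkk CS); have [->|ij] := eqVneq i j.
    by rewrite -mulmxA (cs_idem CS) (cs_bkk CS).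
  rewrite -mulmxA (cs_orth CS) ?mulmx0; last by rewrite eq_sym.
  by rewrite (cs_bkk0 CS) // eq_sym.
rewrite mulmx_sumr linear_sum /= mulmx_sumr mulmx_suml.
by apply: eq_bigr => j _.
Qed.

Lemma wproj_adm a u : wproj a *m ad (u *m Pk) = ad (u *m Pk) *m wproj a.
Proof.
have e i := Pi_adm i u; move: (ad _) e => A e.
rewrite mulmx_suml mulmx_sumr; apply: eq_bigr => i _.
by rewrite -scalemxAl -scalemxAr e.
Qed.

Lemma kproj_adm u : Pk *m ad (u *m Pk) = ad (u *m Pk) *m Pk.
Proof. by rewrite {1}kprojE wproj_adm -kprojE. Qed.

Lemma P_adm u : P *m ad (u *m Pk) = ad (u *m Pk) *m P.
Proof. by rewrite cs_PE mulmxBl mulmxBr mul1mx mulmx1 kproj_adm. Qed.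

(** Here and below, [p, p] in k and [k, p] in p as matrix identities: the left factor restricts the
    argument, the right factor projects the value. *)
Lemma P_admP u : P *m ad (u *m P) *m P = 0.
Proof.
apply/row_matrixP => i; rewrite !rowE !mulmxA mulmx0 mul_adm.
by rewrite (cs_bpp CS).
Qed.

Lemma kproj_admP u : Pk *m ad (u *m P) = Pk *m ad (u *m P) *m P.
Proof.
apply/row_matrixP => i; rewrite !rowE !mulmxA !mul_adm.
rewrite (bracketC lie_c) mulNmx mulmx_sumr bracket_suml mulmx_suml.
by congr (- _); apply: eq_bigr => j _; rewrite (cs_bkp CS).
Qed.

Lemma P_admP_kproj u : P *m ad (u *m P) *m Pk = P *m ad (u *m P).
Proof.
have e : Pk = 1%:M - P by rewrite cs_PE opprB addrCA subrr addr0.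
by rewrite e mulmxBr P_admP subr0 mulmx1.
Qed.

Lemma admP_P u : ad (u *m P) *m P = Pk *m ad (u *m P).
Proof.
by rewrite -[LHS]mul1mx -(cs_one CS) mulmxDl !mulmxA P_admP add0r -kproj_admP.
Qed.

(** Different k_i commute, so inside k a weight put on one argument of a bracket can be moved to its
    value. *)
Lemma kproj_adm_wproj a u : Pk *m ad (u *m wproj a) = ad (u *m Pk) *m wproj a.
Proof.
rewrite -wproj_adm /wproj -/kproj mulmx_suml [RHS]mulmx_suml.
apply: eq_bigr => i _; rewrite -scalemxAl; apply/row_matrixP => l.
rewrite !rowE mulmxA -scalemxAr mulmxA !mul_adm; set e := delta_mx _ _.
rewrite [in LHS]mulmx_sumr bracket_suml (bigD1 i) //= big1 => [|j ji].
  rewrite addr0 -scalemxAr bracketZl; congr (_ *: _).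
  rewrite mulmx_sumr bracket_suml (bigD1 i) //= big1 ?addr0 // => j ji.
  exact: (cs_bkk0 CS).
by rewrite -scalemxAr bracketZl (cs_bkk0 CS) // scaler0.
Qed.

(** * Levi-Civita connection and Ricci tensor of the metric with beta = 1 *)

Section Metric.
Variables (a : 'I_q -> R) (g : 'rV[R]_N -> 'rV[R]_N -> R).
Hypothesis a_gt0 : forall i, 0 < a i.
Local Notation S := (P - wproj a).
Hypothesis gE : forall x y, g x y = B (x *m S) y.

(** [X *m nabla_mx Y] is the covariant derivative of Y along X. It equals [X, Y] / 2 if X and Y both
    lie in k or both in p, - (a_i / 2) [X, Y] for X in p and Y in k_i, and (1 + a_i / 2) [X, Y] for
    X in k_i and Y in p. *)
Definition nabla_mx Y : 'M[R]_N :=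
  2^-1 *: (P *m ad (Y *m wproj a) - Pk *m ad (Y *m Pk)
           - (2 *: Pk + wproj a + P) *m ad (Y *m P)).

Lemma S_unit : S \in unitmx.
Proof.
pose T := P - wproj (fun i => (a i)^-1).
suff e : S *m T = 1%:M by case: (mulmx1_unit e).
rewrite mulmxBl !mulmxBr P_idem P_wproj wproj_P subr0 sub0r opprK wprojM.
rewrite -(cs_one CS); congr (_ + _); rewrite -/kproj kprojE.
by apply: eq_wproj => i; rewrite divff // gt_eqF.
Qed.

Lemma S_adj : S *m G = G *m S^T.
Proof. by rewrite linearB /= mulmxBl mulmxBr P_adj wproj_adj. Qed.

(** The Koszul formula with B stripped off: invariance of B moves Z alone into the second argument
    of each term. *)
Lemma nabla_mxS X Y : X *m nabla_mx Y *m S =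
  2^-1 *: ([[X, Y]] *m S + [[Y, X *m S]] + [[X, Y *m S]]).
Proof.
rewrite -scalemxAr -scalemxAl; congr (_ *: _).
rewrite !(bracketC lie_c X) -!mul_adm !mulNmx -!mulmxA -mulmxN -mulmxDr -mulmxBr.
congr (X *m _).
have adY : ad Y = ad (Y *m P) + ad (Y *m Pk) by rewrite {1}(decomp Y) linearD.
have adS : ad (Y *m S) = ad (Y *m P) - ad (Y *m wproj a).
  by rewrite mulmxBr linearB.
rewrite adS {1 2}adY {adY adS}.
have aP := P_adm Y; have aL := wproj_adm a Y; have ak := kproj_adm Y.
have kb := kproj_adm_wproj a Y.
have PmP := P_admP Y; have km := kproj_admP Y; have mP := admP_P Y.
have bE : ad (Y *m wproj a) = P *m ad (Y *m wproj a) + Pk *m ad (Y *m wproj a).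
  by rewrite -mulmxDl (cs_one CS) mul1mx.
have mE : ad (Y *m P) = P *m ad (Y *m P) + Pk *m ad (Y *m P).
  by rewrite -mulmxDl (cs_one CS) mul1mx.
have bP : P *m ad (Y *m wproj a) *m P = P *m ad (Y *m wproj a).
  have := P_adm (Y *m wproj a); rewrite -mulmxA wproj_kproj => e.
  by rewrite -mulmxA -e mulmxA P_idem.
have LPk := wproj_kproj a; have PL := P_wproj a; have kP := kproj_P.
(* From here only the product rules collected above matter, so the matrices become opaque. The rules
   bring both sides to combinations of the seven products generalised at the end, compared
   entrywise. *)
move: (wproj a) (ad (Y *m P)) (ad (Y *m Pk)) (ad (Y *m wproj a))
  => L m k b in aP aL ak kb PmP km mP bE mE bP LPk PL *.
have PbL : P *m b *m L = 0 by rewrite -bP -mulmxA PL mulmx0.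
have kmL : Pk *m m *m L = 0 by rewrite km -mulmxA PL mulmx0.
have LmP : L *m m *m P = L *m m by rewrite -LPk -!(mulmxA L) -km.
have LmL : L *m m *m L = 0 by rewrite -LmP -mulmxA PL mulmx0.
have kmP : Pk *m m *m P = Pk *m m by rewrite -km.
have kkP : Pk *m k *m P = 0 by rewrite ak -mulmxA kP mulmx0.
have kkL : Pk *m k *m L = k *m L.
  by rewrite ak -mulmxA; congr (_ *m _); rewrite -[RHS]mul1mx -(cs_one CS) mulmxDl PL add0r.
have mL : m *m L = P *m m *m L by rewrite {1}mE mulmxDl kmL addr0.
rewrite !mulmxDl !mulNmx !mulmxDl -!scalemxAl !(mulmxBr, mulmxDr).
rewrite ?mulmxA bP PbL kkP kkL kmP kmL LmP LmL PmP aP aL mP mL.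
have -> : m - b = P *m m + Pk *m m - (P *m b + k *m L) by rewrite -kb -mE -bE.
move: (P *m b) (Pk *m m) (L *m m) (k *m L) (P *m m) (P *m m *m L) (k *m P).
by move=> *; apply/matrixP => i j; rewrite !mxE; ring.
Qed.

Lemma koszulE X Y Z : koszul c g X Y Z = B (X *m nabla_mx Y *m S) Z.
Proof.
rewrite nabla_mxS /koszul !gE mxformZl !mxformDl; congr (_ * (_ + _ + _)).
  rewrite adjoint_form ?S_adj // (bracketC lie_c) mxformNl opprK.
  by rewrite (killing_inv lie_c) mxformC ?kgram_sym.
rewrite adjoint_form ?S_adj // (killing_inv lie_c).
by rewrite mxformC ?kgram_sym.
Qed.

Lemma gram_ofE : gram_of g = S *m G.
Proof.
apply/matrixP => i j; rewrite mxE gE -mxform_ev.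
by rewrite /mxform !mulmxA.
Qed.

Lemma nablaE X Y : nabla c g X Y = X *m nabla_mx Y.
Proof.
have u : S *m G \in unitmx by rewrite unitmx_mul S_unit kgram_unit.
rewrite /nabla gram_ofE -[RHS](mulmxK u); congr (_ *m _).
apply/rowP => l; rewrite mxE koszulE /mxform /ev trmx_delta -colE mxE.
by rewrite !mulmxA.
Qed.

(** Every term is a self-adjoint matrix times an [ad], hence traceless. This removes the first term
    of the curvature from the Ricci trace. *)
Fact nabla_mx_tr0 Y : \tr (nabla_mx Y) = 0.
Proof.
rewrite linearZ /= !linearB /= !tr_adj_adm ?subrr ?mulr0 //.
- have -> : (2 *: Pk + wproj a + P)^T = 2 *: Pk^T + (wproj a)^T + P^T.
    by rewrite !linearD linearZ.
  by rewrite !mulmxDl !mulmxDr P_adj wproj_adj -scalemxAl -scalemxAr kproj_adj.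
- exact: kproj_adj.
- exact: P_adj.
Qed.

Lemma ricci_tr X Y : ricci c g X Y = - \tr (nabla_mx Y *m nabla_mx X).
Proof.
(* Torsion-freeness: it brings the traced variable Z, which the second term of the curvature hides
   inside [nabla_mx], to the left of the product. *)
have torsion U V : U *m nabla_mx V = V *m (nabla_mx U + ad U).
  rewrite mulmxDr mul_adm; apply: (can_inj (mulmxK S_unit)).
  rewrite mulmxDl !nabla_mxS (bracketC lie_c V U) mulNmx.
  move: ([[U, V]] *m S) [[V, U *m S]] [[U, V *m S]] => *.
  by apply/rowP => i; rewrite !mxE; field.
pose M := nabla_mx (X *m nabla_mx Y) - nabla_mx Y *m (nabla_mx X + ad X)
          + ad X *m nabla_mx Y.
have -> : ricci c g X Y = \tr M.
  rewrite /ricci; congr (\tr _); apply/matrixP => i j; rewrite mxE.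
  rewrite /riem !nablaE (torsion X (_ *m _)) (bracketC lie_c (delta_mx 0 i)) mulNmx opprK.
  by rewrite -mul_adm -!mulmxA -mulmxBr -mulmxDr -rowE mxE.
rewrite linearD linearB /= nabla_mx_tr0 sub0r mulmxDr linearD /=.
by rewrite (mxtrace_mulC (ad X)) opprD addrNK.
Qed.

Lemma ricci_trE X Y : ricci c g X Y = - (4^-1 * (
  \tr (P *m ad (Y *m wproj a) *m ad (X *m wproj a))
  + \tr (Pk *m ad (Y *m Pk) *m ad (X *m Pk))
  + 2 * \tr (wproj (fun i => 2 + a i) *m ad (X *m P) *m ad (Y *m P)))).
Proof.
rewrite ricci_tr; congr (- _); rewrite /nabla_mx.
set J := wproj (fun i => 2 + a i).
have -> : 2 *: Pk + wproj a = J.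
  rewrite kprojE scaler_sumr -big_split; apply: eq_bigr => i _.
  by rewrite /= scalerA mulr1 -scalerDl.
have JA : J *m G = G *m J^T by apply: wproj_adj.
have e2 := tr_adj_adm2 (X *m P) (Y *m P) JA.
have bP Z : P *m ad (Z *m wproj a) *m P = P *m ad (Z *m wproj a).
  have := P_adm (Z *m wproj a); rewrite -mulmxA wproj_kproj => e.
  by rewrite -mulmxA -e mulmxA P_idem.
have kP Z : Pk *m ad (Z *m Pk) *m Pk = Pk *m ad (Z *m Pk).
  by rewrite -mulmxA -kproj_adm mulmxA kproj_idem.
have JPk : J *m Pk = J by apply: wproj_kproj.
have PkJ : Pk *m J = J by apply: kproj_wproj.
have PJ : P *m J = 0 by apply: P_wproj.
have JP : J *m P = 0 by apply: wproj_P.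
have Jm Z : J *m ad (Z *m P) *m P = J *m ad (Z *m P).
  by rewrite -JPk -!(mulmxA J) -kproj_admP.
have PmP Z := P_admP Z.
have := (bP Y, bP X, kP Y, kP X, Jm Y, Jm X, PmP Y, PmP X).
rewrite !mulmxDl.
move: J (ad (Y *m wproj a)) (ad (X *m wproj a)) (ad (Y *m Pk)) (ad (X *m Pk))
  (ad (X *m P)) (ad (Y *m P)) JPk PkJ PJ JP e2 {JA bP kP Jm PmP}.
move=> J b b' k k' m' m JPk PkJ PJ JP e2 [] [] [] [] [] [] [] bP b'P kk kk' Jm Jm' PmP PmP'.
have Pk0 := P_kproj; have kP0 := kproj_P; have PP := P_idem.
rewrite -scalemxAl -scalemxAr scalerA linearZ /= -invfM -natrM; congr (_ * _).
rewrite !mulmxBl !mulmxDl.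
rewrite !(mulmxBr, mulmxDr) !mulmxA.
have bk : P *m b *m Pk = 0 by rewrite -bP -mulmxA Pk0 mulmx0.
have bJ : P *m b *m J = 0 by rewrite -bP -mulmxA PJ mulmx0.
have kP : Pk *m k *m P = 0 by rewrite -kk -mulmxA kP0 mulmx0.
have JmPk : J *m m *m Pk = 0 by rewrite -Jm -mulmxA Pk0 mulmx0.
have JmJ : J *m m *m J = 0 by rewrite -Jm -mulmxA PJ mulmx0.
rewrite bk bJ kP kk Jm JmPk JmJ PmP !mul0mx.
have trB (A1 A2 : 'M[R]_N) : \tr (A1 - A2) = \tr A1 - \tr A2 by rewrite linearB.
have trN (A1 : 'M[R]_N) : \tr (- A1) = - \tr A1 by rewrite linearN.
rewrite !(subr0, sub0r, addr0, add0r) !(trB, mxtraceD, trN).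
(* The four mixed terms exchange p and k, so they are off-diagonal and have trace zero. *)
have t1 : \tr (P *m b *m P *m m') = 0.
  by rewrite -!(mulmxA P) mxtrace_mulC -!mulmxA (mulmxA P) PmP' mulmx0 mxtrace0.
have t2 : \tr (Pk *m k *m J *m m') = 0.
  by rewrite -mulmxA -Jm' mulmxA mxtrace_mulC !mulmxA Pk0 !mul0mx mxtrace0.
have t3 : \tr (J *m m *m b') = 0.
  rewrite -Jm -mulmxA -b'P mulmxA mxtrace_mulC !mulmxA PJ !mul0mx.
  exact: mxtrace0.
have t4 : \tr (P *m m *m Pk *m k') = 0.
  rewrite -mulmxA -kk' mulmxA mxtrace_mulC !mulmxA kP0 !mul0mx.
  exact: mxtrace0.
have t5 : \tr (P *m m *m J *m m') = \tr (J *m m' *m m).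
  by rewrite -mulmxA mxtrace_mulC !mulmxA Jm'.
by rewrite t1 t2 t3 t4 t5 bP -e2; ring.
Qed.

End Metric.
(** For X and Y in p, both ad X and ad Y exchange p and k, so by cyclicity the traces over p and
    over k are equal, each being half of B. Summed over i this gives sum_i mu_i = 1/2. *)
Lemma tr_kproj_adP X Y :
  \tr (Pk *m ad (X *m P) *m ad (Y *m P)) = 2^-1 * B (X *m P) (Y *m P).
Proof.
have -> : B (X *m P) (Y *m P) = \tr (P *m ad (X *m P) *m ad (Y *m P))
                                + \tr (Pk *m ad (X *m P) *m ad (Y *m P)).
  by rewrite -mxtraceD -!mulmxDl (cs_one CS) mul1mx -killingE.
have -> : \tr (P *m ad (X *m P) *m ad (Y *m P))
          = \tr (Pk *m ad (X *m P) *m ad (Y *m P)).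
  rewrite -P_admP_kproj -mulmxA mxtrace_mulC !mulmxA -kproj_admP.
  by rewrite tr_adj_adm2 // kproj_adj.
by field.
Qed.

(** * Traces over k_i and over p in terms of kappa_i *)

Section Kappa.
Variable kappa : 'I_q -> R.
Hypothesis kappaE : forall i x y,
  \tr (Pi i *m ad (x *m Pi i) *m ad (y *m Pi i)) = kappa i * B (x *m Pi i) (y *m Pi i).

Lemma Pi_adm0 i j u : i != j -> Pi i *m ad (u *m Pi j) = 0.
Proof.
move=> ij; apply/row_matrixP => l; rewrite !rowE mulmxA mul_adm mulmx0.
by rewrite (cs_bkk0 CS) // eq_sym.
Qed.

Lemma Pi_adm_stable i u : Pi i *m ad (u *m Pk) = Pi i *m ad (u *m Pk) *m Pi i.
Proof. by rewrite -mulmxA -Pi_adm mulmxA (cs_idem CS). Qed.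

Lemma tr_Pi_adk i x y : \tr (Pi i *m ad (x *m Pk) *m ad (y *m Pk))
  = kappa i * B (x *m Pi i) (y *m Pi i).
Proof.
have red u : Pi i *m ad (u *m Pk) = Pi i *m ad (u *m Pi i).
  rewrite mulmx_sumr linear_sum /= mulmx_sumr (bigD1 i) //= big1 ?addr0 // => j ji.
  by rewrite Pi_adm0 // eq_sym.
rewrite -kappaE [in LHS]Pi_adm_stable -[in LHS]mulmxA (red y).
by rewrite mulmxA -Pi_adm_stable (red x).
Qed.

Lemma tr_kproj_adk x y : \tr (Pk *m ad (x *m Pk) *m ad (y *m Pk))
  = \sum_i kappa i * B (x *m Pi i) (y *m Pi i).
Proof.
rewrite [X in X *m ad _ *m _]/kproj !mulmx_suml linear_sum /=.
by apply: eq_bigr => i _; rewrite tr_Pi_adk.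
Qed.

(** B on k is the trace over g; removing the trace over k, which contributes kappa_i on k_i, leaves
    the factor 1 - kappa_i. *)
Lemma tr_P_adk x y : \tr (P *m ad (x *m Pk) *m ad (y *m Pk))
  = \sum_i (1 - kappa i) * B (x *m Pi i) (y *m Pi i).
Proof.
have -> : \tr (P *m ad (x *m Pk) *m ad (y *m Pk))
    = B (x *m Pk) (y *m Pk) - \tr (Pk *m ad (x *m Pk) *m ad (y *m Pk)).
  apply/eqP; rewrite eq_sym subr_eq -mxtraceD -!mulmxDl (cs_one CS) mul1mx.
  by rewrite -killingE.
rewrite tr_kproj_adk {1}/kproj mulmx_sumr mxform_suml -sumrB.
apply: eq_bigr => i _; rewrite mulrBl mul1r; congr (_ - _).
rewrite -{1}(cs_idem CS) mulmxA adjoint_form ?(cs_adj CS) //.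
by rewrite -mulmxA kproj_Pi.
Qed.

Lemma tr_P_adw (a : 'I_q -> R) x y :
  \tr (P *m ad (x *m wproj a) *m ad (y *m wproj a))
  = \sum_i (1 - kappa i) * a i ^+ 2 * B (x *m Pi i) (y *m Pi i).
Proof.
rewrite -[in LHS]wproj_kproj !mulmxA tr_P_adk.
apply: eq_bigr => i _; rewrite -!mulmxA wproj_Pi -!scalemxAr.
by rewrite mxformZl mxformZr -mulrA expr2 !mulrA.
Qed.

Lemma ricci_diagonal (a : 'I_q -> R) g (mu : 'I_q -> R) X Y :
  (forall i, 0 < a i) ->
  (forall x y, g x y = B (x *m (P - wproj a)) y) ->
  (forall i x y, \tr (Pi i *m ad (x *m P) *m ad (y *m P)) = mu i * B (x *m P) (y *m P)) ->
  ricci c g X Y = - (2^-1 * (\sum_i (2 + a i) * mu i) * B (X *m P) (Y *m P)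
    + \sum_i 4^-1 * (kappa i + (1 - kappa i) * a i ^+ 2) * B (X *m Pi i) (Y *m Pi i)).
Proof.
move=> a0 gE muE; rewrite (ricci_trE a0 gE) tr_P_adw tr_kproj_adk.
have -> : \tr (wproj (fun i => 2 + a i) *m ad (X *m P) *m ad (Y *m P))
    = (\sum_i (2 + a i) * mu i) * B (X *m P) (Y *m P).
  rewrite /wproj !mulmx_suml linear_sum mulr_suml /=; apply: eq_bigr => i _.
  by rewrite -!scalemxAl linearZ /= muE mulrA.
have -> : \sum_i 4^-1 * (kappa i + (1 - kappa i) * a i ^+ 2) * B (X *m Pi i) (Y *m Pi i)
    = 4^-1 * (\sum_i (1 - kappa i) * a i ^+ 2 * B (Y *m Pi i) (X *m Pi i)
              + \sum_i kappa i * B (Y *m Pi i) (X *m Pi i)).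
  rewrite -big_split mulr_sumr /=; apply: eq_bigr => i _.
  by rewrite mxformC ?kgram_sym //; ring.
by field.
Qed.

End Kappa.

Lemma posdef_metric a : (forall i, 0 < a i) -> posdefmx ((P - wproj a) *m G).
Proof.
move=> a0; have adj := S_adj a; split.
  by rewrite trmx_mul kgram_sym adj.
move=> x x0.
have -> : mxform ((P - wproj a) *m G) x x
    = B (x *m P) (x *m P) + \sum_i a i * - B (x *m Pi i) (x *m Pi i).
  transitivity (B (x *m (P - wproj a)) x); first by rewrite /mxform !mulmxA.
  have sq M : M *m M = M -> M *m G = G *m M^T -> B (x *m M) (x *m M) = B (x *m M) x.
    by move=> MM MG; rewrite -adjoint_form // -mulmxA MM.
  rewrite mulmxBr mxformDl mxformNl (sq P P_idem P_adj); congr (_ + _).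
  rewrite /wproj mulmx_sumr mxform_suml -sumrN.
  apply: eq_bigr => i _; rewrite -scalemxAr mxformZl mulrN.
  by rewrite (sq _ (cs_idem CS i) (cs_adj CS i)).
have Bi i : 0 <= a i * - B (x *m Pi i) (x *m Pi i).
  rewrite mulr_ge0 ?(ltW (a0 i)) // oppr_ge0.
  by have [->|/(cs_neg CS)/ltW//] := eqVneq (x *m Pi i) 0; rewrite mxform0l.
have [xP|xP] := eqVneq (x *m P) 0; last first.
  by rewrite ltr_wpDr ?(cs_pos CS) // sumr_ge0.
rewrite xP mxform0l add0r lt_def sumr_ge0 // andbT.
apply: contra x0 => /eqP /psumr_eq0P h.
rewrite (decomp_sum x) xP add0r big1 // => i _.
apply/eqP/negPn/negP => xi; have := h (fun i _ => Bi i) i isT.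
by apply/eqP; rewrite gt_eqF // mulr_gt0 // oppr_gt0 (cs_neg CS).
Qed.

Lemma wproj_comm_metric b a : wproj b *m (P - wproj a) = (P - wproj a) *m wproj b.
Proof.
rewrite mulmxBr mulmxBl wproj_P P_wproj !wprojM; congr (_ - _).
by apply: eq_wproj => i; rewrite mulrC.
Qed.

(* [M ad x] is skew for the positive definite form [(P - Pk) G]. *)
Lemma tr_sqr_ad M u : M *m (P - Pk) = (P - Pk) *m M -> M *m G = G *m M^T ->
  M *m ad (u *m Pk) = ad (u *m Pk) *m M -> M *m M = M ->
  \tr (M *m ad (u *m Pk) *m ad (u *m Pk)) <= 0 /\
  (\tr (M *m ad (u *m Pk) *m ad (u *m Pk)) = 0 -> M *m ad (u *m Pk) = 0).
Proof.
move=> MS MG MA MM; have -> : M *m ad (u *m Pk) *m ad (u *m Pk)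
    = M *m ad (u *m Pk) *m (M *m ad (u *m Pk)).
  by rewrite {2}MA !mulmxA -(mulmxA _ M M) MM MA.
apply: (@mxtrace_sqr_skew _ _ ((P - Pk) *m G)).
  by rewrite kprojE; apply: posdef_metric.
have SA : ad (u *m Pk) *m (P - Pk) = (P - Pk) *m ad (u *m Pk).
  by rewrite mulmxBr mulmxBl kproj_adm P_adm.
rewrite trmx_mul {1}MA -!mulmxA; rewrite [M *m (_ *m G)]mulmxA MS.
rewrite -!mulmxA MG !mulmxA SA -(mulmxA (P - Pk)) (adm_skew lie_c).
by rewrite mulmxN mulNmx !mulmxA.
Qed.

(** * Consequences of simplicity: bounds on kappa_i, Schur's lemma on p, the constants mu_i *)

Hypothesis simp : simple_lie c 1%:M.

Lemma derived_mulmx (V M W : 'M[R]_N) :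
  (forall a b, (a <= V)%MS -> (b <= V)%MS -> ([[a, b]] *m M <= W)%MS) ->
  (derived c V *m M <= W)%MS.
Proof.
move=> h; rewrite /derived sumsmxMr; apply/sumsmx_subP => i _.
rewrite sumsmxMr; apply/sumsmx_subP => j _.
rewrite (eqmxMr _ (genmxE _)); apply: h; exact: row_sub.
Qed.

Lemma bracket_derived (V : 'M[R]_N) a b :
  (a <= V)%MS -> (b <= V)%MS -> ([[a, b]] <= derived c V)%MS.
Proof.
move=> /submxP [A ->] /submxP [A' ->]; rewrite /derived.
rewrite -mul_adm -mulmxA mulmx_sub //; apply/row_subP => j.
rewrite row_mul mul_adm (mulmx_sum_row A) bracket_suml summx_sub // => i _.
rewrite bracketZl scalemx_sub // (sumsmx_sup i) // (sumsmx_sup j) //.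
by rewrite genmxE.
Qed.

(** E + [E, E] is a nonzero ideal. By the last hypothesis every x acts on E, and by the Jacobi
    identity on [E, E], like an element of k + E. Elements of k preserve both summands, while E maps
    E into [E, E] and maps [E, E], which lies in k, back into E. *)
Lemma ideal_full (E : 'M[R]_N) : (E <= P)%MS -> E != 0 ->
  (forall z e, (e <= E)%MS -> ([[z *m Pk, e]] <= E)%MS) ->
  (forall x, exists2 e, (e <= E)%MS &
     forall y, (y <= E)%MS -> [[x *m P - e, y]] = 0) ->
  (1%:M <= E + derived c E)%MS.
Proof.
move=> EP E0 stab spl; set D := derived c E.
have EPid e : (e <= E)%MS -> e *m P = e.
  by move=> /submx_trans /(_ EP) /submxP [A ->]; rewrite -mulmxA P_idem.
have Dk x : (x <= D)%MS -> x *m Pk = x.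
  move=> xD; rewrite [RHS]decomp; suff -> : x *m P = 0 by rewrite add0r.
  have /submxP [A ->] := xD; rewrite -mulmxA.
  suff : (D *m P <= (0 : 'M[R]_N))%MS by rewrite submx0 => /eqP ->; rewrite mulmx0.
  apply: derived_mulmx => a b /EPid <- /EPid <-.
  by rewrite (cs_bpp CS) sub0mx.
have [_ [_ ideals] ] := simp.
have /ideals : ideal_of c (E + D)%MS 1%:M.
  split; first exact: submx1.
  move=> x y _; rewrite -mul_adm => /sub_addsmxP [] [A A'] /= ->.
  have [e eE xe] := spl x.
  have xE : x = x *m Pk + e + (x *m P - e).
    by rewrite {1}(decomp x) addrACA subrr addr0 addrC.
  move: (x *m P - e) xe xE => f xe xE.
  rewrite mulmxDl addmx_sub //.
    set y' := A *m E; have yE : (y' <= E)%MS by rewrite submxMl.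
    rewrite mul_adm {1}xE !bracketDl xe // addr0 addmx_sub_adds ?stab //.
    by rewrite bracket_derived.
  rewrite -mulmxA mulmx_sub //; apply: derived_mulmx => a b aE bE.
  rewrite mul_adm {1}xE !bracketDl !(jacobi lie_c f) !xe //.
  rewrite bracket0l linear0 !addr0 addrC addmx_sub_adds //.
    rewrite (bracketC lie_c) -(Dk [[a, b]]) ?bracket_derived // eqmx_opp stab //.
  rewrite (jacobi lie_c) addmx_sub // bracket_derived ?stab //.
case=> [/eqP|/andP []//]; rewrite mxrank_eq0 => /eqP ED0.
by case/eqP: E0; apply/eqP; rewrite -submx0 -ED0 addsmxSl.
Qed.

(** By the Jacobi identity x also centralises [p, p], hence all of g by [ideal_full], so ad x = 0
    and B(x, .) = 0. Pairing x with its image under P - Pk contradicts positivity unless x = 0. *)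
Lemma centralizer_P0 x : P != 0 -> (forall y, [[x, y *m P]] = 0) -> x = 0.
Proof.
move=> P0 xP; have /(_ (submx_refl _) P0) full := @ideal_full P.
have {}full : (1%:M <= P + derived c P)%MS.
  apply: full => [z e|y].
    case/submxP => A ->; rewrite -mul_adm -mulmxA P_adm mulmxA.
    by rewrite submxMl.
  by exists (y *m P); rewrite ?submxMl // => w _; rewrite subrr bracket0l.
have PP e : (e <= P)%MS -> [[x, e]] = 0 by case/submxP => A ->; apply: xP.
have ad0 : ad x = 0.
  apply/eqP; rewrite -submx0 -[ad x]mul1mx.
  apply: submx_trans (submxMr _ full) _; rewrite addsmxMr addsmx_sub.
  apply/andP; split.
    apply/row_subP => i; rewrite row_mul mul_adm PP ?sub0mx //.
    exact: row_sub.
  apply: derived_mulmx => a b aP bP.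
  by rewrite mul_adm (jacobi lie_c) !PP // bracket0l linear0 addr0 sub0mx.
apply/eqP/negPn/negP => x0.
have [_] := posdef_metric (fun _ => ltr01); move/(_ x x0).
have -> : mxform ((P - wproj (fun=> 1)) *m G) x x
          = B x (x *m (P - wproj (fun=> 1))).
  by rewrite -(adjoint_form _ _ (S_adj _)) /mxform !mulmxA.
by rewrite -killingE /killing ad0 mul0mx mxtrace0 ltxx.
Qed.

Section KappaBounds.
Variable kappa : 'I_q -> R.
Hypothesis kappaE : forall i x y,
  \tr (Pi i *m ad (x *m Pi i) *m ad (y *m Pi i)) = kappa i * B (x *m Pi i) (y *m Pi i).

(** ad x acts on k_i by a skew map, so its square has nonpositive trace there, while B(x, x) < 0. *)
Lemma kappa_ge0 i : Pi i != 0 -> 0 <= kappa i.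
Proof.
move=> Pi0; have [l xi] := row_neq0 Pi0; rewrite rowE -/(ev R l) in xi.
have [] := @tr_sqr_ad (Pi i) (ev R l *m Pi i).
- by rewrite PiE kprojE wproj_comm_metric.
- exact: (cs_adj CS).
- exact: Pi_adm.
- exact: (cs_idem CS).
rewrite -(mulmxA _ (Pi i) Pk) Pi_kproj kappaE => + _.
by rewrite nmulr_lle0 ?(cs_neg CS).
Qed.

(** The same sign argument on p gives kappa_i <= 1. Equality would make ad x vanish on p for some
    nonzero x in k_i, against [centralizer_P0]. *)
Lemma kappa_lt1 i : P != 0 -> Pi i != 0 -> kappa i < 1.
Proof.
move=> P0 Pi0; have [l xi] := row_neq0 Pi0; rewrite rowE -/(ev R l) in xi.
set x := ev R l *m Pi i in xi; have xk : x *m Pk = x by rewrite -mulmxA Pi_kproj.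
have [] := @tr_sqr_ad P x.
- by rewrite kprojE mulmxBr mulmxBl P_wproj wproj_P.
- exact: P_adj.
- exact: P_adm.
- exact: P_idem.
rewrite (tr_P_adk kappaE) (bigD1 i) //= big1 => [|j ji]; last first.
  by rewrite /x -mulmxA (cs_orth CS) ?mulmx0 ?mxform0l ?mulr0 // eq_sym.
rewrite addr0 xk {1 2}/x -!mulmxA (cs_idem CS) -/x.
have Bx := cs_neg CS xi; rewrite nmulr_lle0 // subr_ge0 le_eqVlt => /orP [/eqP ->|//].
rewrite subrr mul0r => /(_ erefl) Padx.
case/eqP: xi; apply: centralizer_P0 => // y.
by rewrite -mul_adm -mulmxA Padx mulmx0.
Qed.

End KappaBounds.

Lemma bracket_kP z x : [[z *m Pk, x *m P]] = [[z *m Pk, x]] *m P.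
Proof. by rewrite -!mul_adm -!mulmxA P_adm. Qed.

(** M is symmetric on the Euclidean space (p, B), so it has a real eigenvalue mu, with an
    ad(k)-invariant eigenspace E. If e' in p is orthogonal to E and y is in E, then [e', y] lies in
    k and B([e', y], z) = B(e', [y, z]) = 0 for z in k, so e' commutes with E. Now [ideal_full]
    applies, and projecting g = E + [E, E] to p gives E = p. *)
Lemma schur_p M : (0 < \rank P)%N -> M *m G = G *m M^T -> P *m M = M -> M *m P = M ->
  (forall z, M *m ad (z *m Pk) = ad (z *m Pk) *m M) -> exists mu, M = mu *: P.
Proof.
move=> P0 MG PM MP Mad.
have [V Vfree VeqP] : exists2 V : 'M_(\rank P, N), row_free V & (V :=: P)%MS.
  by exists (row_base P); [apply: row_base_free|apply: eq_row_base].
have VP : V *m P = V.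
  have /submxP [A ->] : (V <= P)%MS by rewrite VeqP.
  by rewrite -mulmxA P_idem.
have /submxP [A VM] : (V *m M <= V)%MS.
  by rewrite VeqP -MP mulmxA submxMl.
have [||mu] := @real_eigenvalue _ _ A (V *m G *m V^T) P0.
- split; first by rewrite !(trmx_mul _ V^T, trmx_mul V) trmxK kgram_sym mulmxA.
  move=> u u0; have -> : mxform (V *m G *m V^T) u u = B (u *m V *m P) (u *m V *m P).
    by rewrite -(mulmxA u) VP /mxform (trmx_mul u) !mulmxA.
  apply: (cs_pos CS); rewrite -mulmxA VP.
  by apply: contra_neq u0 => uV; apply: (row_free_inj Vfree); rewrite /= uV mul0mx.
- rewrite !mulmxA -VM -(mulmxA V M G) MG -!mulmxA -(trmx_mul V M) VM.
  by rewrite (trmx_mul A V).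
move=> /eigenvalueP [u uA u0].
set E := (P :&: kermx (M - mu%:M))%MS.
have EE x : (x <= E)%MS = (x <= P)%MS && (x *m M == mu *: x).
  rewrite sub_capmx; congr (_ && _); rewrite sub_kermx mulmxBr mul_mx_scalar.
  by rewrite subr_eq0.
have E0 : E != 0.
  have uVE : (u *m V <= E)%MS.
    rewrite EE -VeqP submxMl /= -mulmxA VM mulmxA uA -scalemxAl.
    exact: eqxx.
  apply: contra_neq u0 => Ez; move: uVE; rewrite Ez submx0 => /eqP uV.
  by apply: (row_free_inj Vfree); rewrite /= uV mul0mx.
have EP : (E <= P)%MS := capmxSl _ _.
have EPid x : (x <= E)%MS -> x *m P = x.
  by move=> /submx_trans /(_ EP) /submxP [D ->]; rewrite -mulmxA P_idem.
have stab z e : (e <= E)%MS -> ([[z *m Pk, e]] <= E)%MS.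
  move=> eE; have := eE; rewrite !EE => /andP [_ /eqP eM].
  rewrite -{1}(EPid e eE) bracket_kP submxMl /=.
  by rewrite -!mul_adm -mulmxA -Mad mulmxA eM -scalemxAl.
have aniE : anisotropic G E.
  move=> x xE; rewrite -(EPid x xE) => Bx; apply/eqP/negPn/negP => /(cs_pos CS).
  by rewrite Bx ltxx.
have [F FE] := orthprojmx_exists (kgram_sym c) aniE.
have orthF x e : (e <= E)%MS -> B (x *m P - x *m P *m F) e = 0.
  move=> eE; rewrite mxformDl mxformNl (orthprojmx_adj _ _ FE).
  by rewrite (orthprojmx_id FE eE) subrr.
have full : (1%:M <= E + derived c E)%MS.
  apply: ideal_full => // x.
  exists (x *m P *m F); first by rewrite (orthprojmx_sub _ FE).
  move=> y yE; set e' := x *m P - _.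
  have e'P : e' *m P = e'.
    by rewrite mulmxBl -(mulmxA x P P) P_idem (EPid (x *m P *m F)) ?(orthprojmx_sub _ FE).
  set w := [[e', y]]; have wk : w *m Pk = w.
    rewrite [RHS]decomp /w -e'P -(EPid y yE) (cs_bpp CS).
    by rewrite add0r.
  have Bw z : B w (z *m Pk) = 0.
    rewrite /w (killing_inv lie_c) (bracketC lie_c) mxformNr.
    by rewrite orthF ?oppr0 // stab.
  rewrite -wk [LHS]mulmx_sumr big1 // => i _; apply/eqP/negPn/negP => /(cs_neg CS).
  by rewrite (adjoint_form _ _ (cs_adj CS i)) -(Pi_kproj i) !mulmxA Bw ltxx.
exists mu; have PE : (P <= E)%MS.
  have /(submxMr P) := full; rewrite mul1mx => /submx_trans; apply.
  rewrite addsmxMr addsmx_sub; apply/andP; split.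
    by apply/rV_subP => x /submxP [D ->]; rewrite mulmxA EPid ?submxMl // submxMl.
  apply: derived_mulmx => a b aE bE.
  by rewrite -(EPid a aE) -(EPid b bE) (cs_bpp CS) sub0mx.
apply/row_matrixP => i; rewrite -PM row_mul.
have : (row i P <= E)%MS by rewrite (submx_trans (row_sub _ _)).
by rewrite EE => /andP [_ /eqP ->]; rewrite linearZ.
Qed.

Local Notation dual i := (row i (invmx G)).

Lemma B_dual x i : B x (dual i) = x 0 i.
Proof.
rewrite /mxform tr_row trmx_inv kgram_sym colE mulmxA mulmxK ?kgram_unit //.
by rewrite -colE mxE.
Qed.

Lemma tr_dual (M : 'M[R]_N) : \tr M = \sum_i B (ev R i *m M) (dual i).
Proof. by apply: eq_bigr => i _; rewrite B_dual -rowE mxE. Qed.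

(* Both sides equal [- \sum_(i, j) B [e_i T, e_j S] [e^i, e^j]], with [e^i] the
   [B]-dual basis. *)
Lemma tr_adm_dual_swap (S T : 'M[R]_N) :
  \sum_i \tr (S *m ad (ev R i *m T) *m ad (dual i)) =
  \sum_i \tr (T *m ad (ev R i *m S) *m ad (dual i)).
Proof.
have e U V : \sum_i \tr (U *m ad (ev R i *m V) *m ad (dual i)) =
    - \sum_i \sum_j B [[ev R i *m V, ev R j *m U]] [[dual i, dual j]].
  rewrite -sumrN; apply: eq_bigr => i _; rewrite tr_dual -sumrN.
  apply: eq_bigr => j _.
  by rewrite !mulmxA killing_adm // !mul_adm.
rewrite !e exchange_big; congr (- _); apply: eq_bigr => i _; apply: eq_bigr => j _.
by rewrite (bracketC lie_c) (bracketC lie_c (dual j)) mxformNl mxformNr opprK.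
Qed.

Section Mu.
Variable kappa : 'I_q -> R.
Hypothesis kappaE : forall i x y,
  \tr (Pi i *m ad (x *m Pi i) *m ad (y *m Pi i)) = kappa i * B (x *m Pi i) (y *m Pi i).

Lemma Pi_admP i u : Pi i *m ad (u *m P) *m P = Pi i *m ad (u *m P).
Proof. by rewrite -Pi_kproj -!(mulmxA (Pi i)) -kproj_admP. Qed.

(** The form [tau] is represented through B by a self-adjoint M commuting with ad(k), so [schur_p]
    applies. The second equation is [tr_adm_dual_swap] for [Pi i] and [P]: one side contracts [tau]
    over p, the other contracts the form of [tr_P_adk] over k_i. *)
Lemma mu_exists i : (0 < \rank P)%N -> exists2 mu,
  forall x y, \tr (Pi i *m ad (x *m P) *m ad (y *m P)) = mu * B (x *m P) (y *m P) &
  mu * \tr P = (1 - kappa i) * \tr (Pi i).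
Proof.
move=> P0.
pose tau x y := \tr (Pi i *m ad (x *m P) *m ad (y *m P)).
have tauC x y : tau x y = tau y x by rewrite /tau tr_adj_adm2 ?(cs_adj CS).
have tauE x y : tau x y = mxform (gram_of tau) x y.
  have lin x' : linear (tau x' : _ -> R^o).
    move=> b u v; rewrite /tau mulmxDl -scalemxAl linearD linearZ /=.
    by rewrite mulmxDr -scalemxAr linearD linearZ.
  pose f x' := HB.pack_for {linear 'rV[R]_N -> R^o} (tau x')
    (GRing.isLinear.Build R _ _ _ (tau x') (lin x')).
  have sumr x' y' : tau x' y' = \sum_j y' 0 j * tau x' (ev R j).
    rewrite {1}(rowE_ev y') -[tau x' _]/(f x' _) linear_sum.
    by apply: eq_bigr => j _; rewrite linearZ.
  rewrite sumr {2}(rowE_ev y) mxform_sumr; apply: eq_bigr => j _.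
  rewrite mxformZr; congr (_ * _).
  rewrite tauC sumr {2}(rowE_ev x) mxform_suml; apply: eq_bigr => l _.
  by rewrite mxformZl mxform_ev mxE tauC.
have [M ME] : exists M, forall x y, B (x *m M) y = tau x y.
  exists (gram_of tau *m invmx G) => x y.
  by rewrite tauE /mxform -!mulmxA mulKmx ?kgram_unit.
have injB (x y : 'rV[R]_N) : (forall z, B x z = B y z) -> x = y.
  move=> h; apply/rowP => l; rewrite -!B_dual; exact: h.
have MG : M *m G = G *m M^T.
  apply: eq_mxform => x y; transitivity (B (x *m M) y).
    by rewrite /mxform !mulmxA.
  rewrite ME tauC -ME mxformC ?kgram_sym // /mxform (trmx_mul y).
  by rewrite !mulmxA.
have rowM (M1 M2 : 'M[R]_N) : (forall x : 'rV[R]_N, x *m M1 = x *m M2) -> M1 = M2.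
  by move=> h; apply/row_matrixP => l; rewrite !rowE h.
have PM : P *m M = M.
  apply: rowM => x; apply: injB => z; rewrite mulmxA !ME.
  by rewrite /tau -(mulmxA x) P_idem.
have MP : M *m P = M.
  apply: rowM => x; apply: injB => z; rewrite mulmxA (adjoint_form _ _ P_adj) !ME.
  by rewrite /tau -(mulmxA z) P_idem.
have Mad z : M *m ad (z *m Pk) = ad (z *m Pk) *m M.
  apply: rowM => x; apply: injB => y; rewrite !mulmxA.
  rewrite (killing_adm lie_c) !ME !mul_adm /tau.
  rewrite -!bracket_kP !(adm_bracket lie_c) !mulmxBr mulmxBl !linearB /=.
  rewrite opprB !mulmxA; congr (_ - _).
  by rewrite mxtrace_mulC !mulmxA Pi_adm.
have [mu Mmu] := schur_p P0 MG PM MP Mad.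
have muE x y : tau x y = mu * B (x *m P) (y *m P).
  by rewrite -ME Mmu -scalemxAr mxformZl -(adjoint_form _ _ P_adj) -(mulmxA x) P_idem.
exists mu => //.
have := tr_adm_dual_swap (Pi i) P.
have -> : \sum_j \tr (Pi i *m ad (ev R j *m P) *m ad (dual j)) = mu * \tr P.
  rewrite tr_dual mulr_sumr; apply: eq_bigr => j _.
  rewrite {1}(decomp (dual j)) linearD /= mulmxDr mxtraceD -[X in X + _]/(tau _ _).
  rewrite muE (adjoint_form _ _ P_adj) -!mulmxA !P_idem.
  (* The k-component of [dual j] contributes a product that maps k_i into p, hence trace zero. *)
  rewrite -(adjoint_form _ _ P_adj) [X in _ + X](_ : _ = 0) ?addr0 //.
  rewrite !mulmxA -Pi_admP -mulmxA P_adm mulmxA mxtrace_mulC !mulmxA (cs_PPi CS).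
  by rewrite !mul0mx mxtrace0.
have -> // : \sum_j \tr (P *m ad (ev R j *m Pi i) *m ad (dual j))
    = (1 - kappa i) * \tr (Pi i).
rewrite tr_dual mulr_sumr; apply: eq_bigr => j _.
set x := ev R j *m Pi i; have xk : x *m Pk = x by rewrite -mulmxA Pi_kproj.
rewrite {1}(decomp (dual j)) linearD /= mulmxDr mxtraceD [X in X + _](_ : _ = 0).
  rewrite add0r -{1}xk (tr_P_adk kappaE) (bigD1 i) //= big1 => [|l li].
    by rewrite addr0 -(adjoint_form _ _ (cs_adj CS i)) /x -!mulmxA !(cs_idem CS).
  by rewrite /x -mulmxA (cs_orth CS) ?mulmx0 ?mxform0l ?mulr0 // eq_sym.
rewrite -xk P_adm -mulmxA -P_admP_kproj !mulmxA mxtrace_mulC !mulmxA.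
by rewrite kproj_adm -!mulmxA (mulmxA Pk P) kproj_P mul0mx mulmx0 mxtrace0.
Qed.

End Mu.
End Ricci.

(** * Structure of k: orthogonal sum of its simple ideals and its centre *)

Section Compact.
Context {R : realType} {N : nat} (c : 'I_N -> 'I_N -> 'rV[R]_N) (k : 'M[R]_N).
Hypothesis lie_c : is_lie_algebra c.
Hypothesis k_sub : subalgebra c k.
Hypothesis k_neg : forall x, (x <= k)%MS -> x != 0 -> killing c x x < 0.
Local Notation br := (bracket c).
Local Notation ad := (adm c).
Local Notation G := (kgram c).
Local Notation B := (mxform G).
Implicit Types (x y z : 'rV[R]_N) (I J V W : 'M[R]_N).

Lemma derived_sub V W :
  (forall a b, (a <= V)%MS -> (b <= V)%MS -> (br a b <= W)%MS) ->
  (derived c V <= W)%MS.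
Proof.
by move=> h; rewrite -[derived c V]mulmx1; apply: derived_mulmx => a b aV bV;
  rewrite mulmx1 h.
Qed.

Lemma k_anisotropic I : (I <= k)%MS -> anisotropic G I.
Proof.
move=> Ik x xI Bx; apply/eqP/negPn/negP => /k_neg.
by rewrite killingE Bx ltxx => /(_ (submx_trans xI Ik)).
Qed.

Lemma ideal_bracketC I V x y : ideal_of c I V -> (x <= I)%MS -> (y <= V)%MS ->
  (br x y <= I)%MS.
Proof. by move=> [_ h] xI yV; rewrite (bracketC lie_c) eqmx_opp h. Qed.

Lemma perpP I x : reflect (forall y, (y <= I)%MS -> B x y = 0) (x <= perp c I)%MS.
Proof. exact: kermx_formP. Qed.

Lemma ideal_perp I : ideal_of c I k -> ideal_of c (k :&: perp c I)%MS k.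
Proof.
move=> idI; split; first exact: capmxSl.
move=> x y xk; rewrite !sub_capmx => /andP [yk /perpP yI]; rewrite k_sub //=.
apply/perpP => w wI; rewrite (bracketC lie_c) mxformNl (killing_inv lie_c).
by rewrite yI ?oppr0 //; apply: idI.2.
Qed.

Lemma ideal_decomp I x : ideal_of c I k -> (x <= k)%MS ->
  exists2 y, (y <= I)%MS & (x - y <= k :&: perp c I)%MS.
Proof.
move=> [Ik _] xk; have [F FI] := orthprojmx_exists (kgram_sym c) (k_anisotropic Ik).
exists (x *m F); first exact: orthprojmx_sub FI.
rewrite sub_capmx addmx_sub ?eqmx_opp //=; last first.
  exact: submx_trans (orthprojmx_sub _ FI) Ik.
apply/perpP => y yI; rewrite mxformDl mxformNl (orthprojmx_adj _ _ FI).
by rewrite (orthprojmx_id FI yI) subrr.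
Qed.

(** [x, y] lies in I and in J, so it is B-orthogonal to itself. *)
Lemma orth_ideals_commute I J x y : ideal_of c I k -> ideal_of c J k ->
  (forall x y, (x <= I)%MS -> (y <= J)%MS -> B x y = 0) ->
  (x <= I)%MS -> (y <= J)%MS -> br x y = 0.
Proof.
move=> idI idJ orth xI yJ; have xk := submx_trans xI idI.1.
have yk := submx_trans yJ idJ.1.
apply: (k_anisotropic idI.1); first exact: ideal_bracketC idI xI yk.
by apply: orth; [apply: ideal_bracketC idI xI yk|apply: idJ.2].
Qed.

Lemma simple_derived I : simple_lie c I -> (I <= derived c I)%MS.
Proof.
move=> [subI [[x [y [xI yI xy]]] ideals]].
have dI : (derived c I <= I)%MS by apply: derived_sub.
have /ideals : ideal_of c (derived c I) I.
  split=> // a b aI bI; apply: bracket_derived => //.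
  exact: submx_trans bI dI.
case=> [/eqP|/andP [] //]; rewrite mxrank_eq0 => /eqP d0; case/eqP: xy.
by apply/eqP; rewrite -submx0 -d0 bracket_derived.
Qed.

Lemma derived_k : (derived c k <= k)%MS.
Proof. exact: derived_sub. Qed.

(** Since I = [I, I], the Jacobi identity writes [x, [a, b]] through [x, a] and [x, b], which lie in
    [k, k] and therefore bracket I into I. *)
Lemma simple_ideal I : simple_lie c I -> ideal_of c I (derived c k) -> ideal_of c I k.
Proof.
move=> simI [ID IDI]; split; first exact: submx_trans ID derived_k.
move=> x y xk /submx_trans/(_ (simple_derived simI)) yI.
rewrite -mul_adm; have /submxP [A ->] := yI; rewrite -mulmxA mulmx_sub //.
apply: derived_mulmx => a b aI bI; rewrite mul_adm (jacobi lie_c).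
have ak := submx_trans aI (submx_trans ID derived_k).
have bk := submx_trans bI (submx_trans ID derived_k).
have idI : ideal_of c I (derived c k) by [].
rewrite addmx_sub //; first by apply: IDI => //; apply: bracket_derived.
by apply: ideal_bracketC idI aI _; apply: bracket_derived.
Qed.

Lemma orth_of_commute I W x y : (I <= derived c I)%MS ->
  (forall x y, (x <= I)%MS -> (y <= W)%MS -> br x y = 0) ->
  (x <= I)%MS -> (y <= W)%MS -> B x y = 0.
Proof.
move=> dI comm /submx_trans/(_ dI) xI yW.
have /perpP : (x <= perp c W)%MS; last exact.
apply: submx_trans xI _; apply: derived_sub => a b aI bI; apply/perpP => w wW.
by rewrite (killing_inv lie_c) comm // mxform0r.
Qed.

Section Ideals.
Variables (r s : nat) (kk : 'I_(r + s) -> 'M[R]_N).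
Hypothesis Hkk_simple : forall i : 'I_(r + s), (i < r)%N ->
      simple_lie c (kk i) /\ ideal_of c (kk i) (derived c k).
Hypothesis Hkk_inj : forall i j : 'I_(r + s), (i < r)%N -> (j < r)%N ->
      (kk i == kk j)%MS -> i = j.
Hypothesis Hkk_all : forall I : 'M[R]_N, simple_lie c I -> ideal_of c I (derived c k) ->
      exists i : 'I_(r + s), (i < r)%N /\ (kk i == I)%MS.
Hypothesis Hs : (s <= 1)%N.
Hypothesis Hs1 : s = 1%N <-> exists z : 'rV[R]_N, [/\ z != 0, (z <= k)%MS &
            forall x, (x <= k)%MS -> bracket c x z = 0].
Hypothesis Hcentre : forall i : 'I_(r + s), (r <= i)%N -> forall z : 'rV[R]_N,
      (z <= kk i)%MS <-> ((z <= k)%MS /\ forall x, (x <= k)%MS -> bracket c x z = 0).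

Lemma kk_ideal i : ideal_of c (kk i) k.
Proof.
have [ir|ri] := ltnP i r.
  by have [simI idI] := Hkk_simple ir; apply: simple_ideal.
split; first by apply/rV_subP => x /(Hcentre ri) [].
by move=> x y xk /(Hcentre ri) [_ ->] //; rewrite sub0mx.
Qed.

Lemma kk_sub i : (kk i <= k)%MS. Proof. exact: (kk_ideal i).1. Qed.

Lemma kk_neq0 i : kk i != 0.
Proof.
apply/eqP => kk0; have [ir|ri] := ltnP i r.
  have [[_ [[x [y [xI _ xy]]] _]] _] := Hkk_simple ir; case/eqP: xy.
  by move: xI; rewrite kk0 submx0 => /eqP ->; rewrite bracket0l.
have s1 : s = 1%N.
  apply/eqP; rewrite eqn_leq Hs lt0n; apply/eqP => s0.
  move: (ltn_ord i) ri; move: (nat_of_ord i) => a; rewrite s0 addn0 => h.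
  by rewrite leqNgt h.
have [z [/eqP z0 zk zc]] := Hs1.1 s1; apply: z0.
by apply/eqP; rewrite -submx0 -kk0; apply/(Hcentre ri).
Qed.

(** At most one index is central because s <= 1, so k_i may be taken simple, hence perfect, and it
    suffices that k_i and k_j commute. This is clear if k_j is central. Otherwise their intersection
    is 0, or it is k_i; then k_i is a nonzero ideal of the simple k_j, so both coincide and i =
    j. *)
Lemma kk_orth i j x y : i != j -> (x <= kk i)%MS -> (y <= kk j)%MS -> B x y = 0.
Proof.
wlog ir : i j x y / (i < r)%N => [hw ij xi yj|].
  have [ir|ri] := ltnP i r; first exact: (hw i j).
  have [jr|rj] := ltnP j r.
    by rewrite mxformC ?kgram_sym //; apply: (hw j i) => //; rewrite eq_sym.
  have eq_r (l : 'I_(r + s)) : (r <= l)%N -> l = r :> nat.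
    move=> rl; apply/eqP; rewrite eqn_leq rl andbT -ltnS.
    by rewrite (leq_trans (ltn_ord l)) // -addn1 leq_add2l.
  by case/eqP: ij; apply/val_inj; rewrite /= (eq_r i ri) (eq_r j rj).
move=> ij; apply: orth_of_commute; first exact: simple_derived (Hkk_simple ir).1.
move=> a b ai bj; have [jr|rj] := ltnP j r; last first.
  by have [_ ->] := (Hcentre rj b).1 bj => //; apply: submx_trans ai (kk_sub i).
have cap_ideal : ideal_of c (kk i :&: kk j)%MS (kk i).
  split; first exact: capmxSl.
  move=> u v ui; rewrite !sub_capmx => /andP [vi vj].
  have uk := submx_trans ui (kk_sub i).
  by rewrite (kk_ideal i).2 // (kk_ideal j).2.
have bk := submx_trans bj (kk_sub j); have ak := submx_trans ai (kk_sub i).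
have abC : (br a b <= kk i :&: kk j)%MS.
  by rewrite sub_capmx (ideal_bracketC (kk_ideal i)) // (kk_ideal j).2.
have [[_ [_ ideals]] idi] := Hkk_simple ir.
have [/eqP|/andP [_ ii]] := ideals _ cap_ideal.
  rewrite mxrank_eq0 => /eqP C0; apply/eqP; rewrite -submx0.
  by rewrite C0 in abC.
have ij_sub : (kk i <= kk j)%MS := submx_trans ii (capmxSr _ _).
have [[_ [_ ideals']] idj] := Hkk_simple jr.
have /ideals' : ideal_of c (kk i) (kk j).
  by split=> // u v uj vi; apply: (kk_ideal i).2 => //; apply: submx_trans uj (kk_sub j).
case=> [/eqP|/(Hkk_inj ir jr) eij]; last by case/eqP: ij.
by rewrite mxrank_eq0 (negPf (kk_neq0 i)).
Qed.

Lemma kk_commute i j x y : i != j -> (x <= kk i)%MS -> (y <= kk j)%MS -> br x y = 0.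
Proof.
move=> ij; apply: orth_ideals_commute; try exact: kk_ideal.
by move=> *; apply: (kk_orth ij).
Qed.

Local Notation S := (\sum_i kk i)%MS.

Lemma sum_kk_ideal : ideal_of c S k.
Proof.
split; first by apply/sumsmx_subP => i _; apply: kk_sub.
move=> x y xk /submxP [A ->]; rewrite -mul_adm -mulmxA mulmx_sub // sumsmxMr.
apply/sumsmx_subP => i _; rewrite (sumsmx_sup i) //; apply/row_subP => j.
by rewrite row_mul mul_adm (kk_ideal i).2 // row_sub.
Qed.

Lemma S_perp0 J : (J <= S)%MS -> (J <= perp c S)%MS -> J = 0.
Proof.
move=> JS Jp; apply/eqP/rowV0P => x xJ.
apply: (k_anisotropic sum_kk_ideal.1); first exact: submx_trans xJ JS.
have /perpP -> // := submx_trans xJ Jp; exact: submx_trans xJ JS.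
Qed.

(** Induction on the rank. The orthogonal of J in k commutes with J, so ideals of J are ideals of k,
    and by induction the proper ones vanish. Hence J is simple, and then some k_i, or abelian, and
    then central in k. If J were nonzero, it would meet S nontrivially while being orthogonal to
    it. *)
Lemma ideal_perp_sum0 J : ideal_of c J k -> (J <= perp c S)%MS -> J = 0.
Proof.
have [n] := ubnP (\rank J); elim: n J => // n IHn J ltJ idJ Jp.
have [//|J0] := eqVneq J 0.
pose J' := (k :&: perp c J)%MS.
have idJ' : ideal_of c J' k := ideal_perp idJ.
have JJ' x y : (x <= J)%MS -> (y <= J')%MS -> br x y = 0.
  apply: orth_ideals_commute => // {}x {}y xJ.
  rewrite sub_capmx => /andP [_ /perpP h]; rewrite mxformC ?kgram_sym //.
  exact: h.
have idealJ I : ideal_of c I J -> ideal_of c I k.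
  move=> [IJ IJI]; split; first exact: submx_trans IJ idJ.1.
  move=> x y xk yI; have [u uJ xu] := ideal_decomp idJ xk.
  rewrite -(subrK u x) bracketDl (bracketC lie_c (x - u)).
  by rewrite (JJ' y) ?oppr0 ?add0r ?IJI // (submx_trans yI).
have minJ I : ideal_of c I J -> \rank I = 0%N \/ (I == J)%MS.
  move=> idI; have IJ := idI.1; have [|ge] := ltnP (\rank I) (\rank J); last first.
    by right; rewrite IJ -(mxrank_leqif_sup IJ).2 eqn_leq ge mxrankS.
  move=> ltI; left; rewrite (IHn I) ?mxrank0 //.
  - exact: leq_trans ltI ltJ.
  - exact: idealJ.
  - exact: submx_trans IJ Jp.
have subJ : subalgebra c J.
  by move=> x y xJ yJ; apply: idJ.2 => //; apply: submx_trans xJ idJ.1.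
have [/existsP [i /existsP [j ij]]|] :=
  boolP [exists i, exists j, br (row i J) (row j J) != 0].
  have simJ : simple_lie c J.
    by split=> //; split=> //; exists (row i J), (row j J); rewrite !row_sub.
  have [|l [lr /andP [_ Jl]]] := Hkk_all simJ.
    split=> [|x y xD yJ]; last by apply: idJ.2 => //; apply: submx_trans xD derived_k.
    apply: submx_trans (simple_derived simJ) _; apply: derived_sub => a b aJ bJ.
    by apply: bracket_derived; [apply: submx_trans aJ idJ.1|apply: submx_trans bJ idJ.1].
  apply: S_perp0 => //; apply: submx_trans Jl _; exact: sumsmx_sup.
rewrite negb_exists => /forallP abJ.
have {}abJ : derived c J = 0.
  rewrite /derived big1 // => i _; rewrite big1 // => j _.
  have := abJ i; rewrite negb_exists => /forallP/(_ j)/negPn/eqP ->.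
  exact: genmx0.
have Jc z x : (z <= J)%MS -> (x <= k)%MS -> br x z = 0.
  move=> zJ xk; have [u uJ xu] := ideal_decomp idJ xk.
  rewrite -(subrK u x) bracketDl (bracketC lie_c (x - u)) (JJ' z) // oppr0 add0r.
  by apply/eqP; rewrite -submx0 -abJ bracket_derived.
have nz : nz_row J != 0 by rewrite nz_row_eq0.
have nzJ := nz_row_sub J; have nzk := submx_trans nzJ idJ.1.
have s1 : s = 1%N.
  by apply/Hs1; exists (nz_row J); split=> // x; apply: Jc.
have lt_r : (r < r + s)%N by rewrite s1 addn1.
have nzS : (nz_row J <= S)%MS.
  rewrite (sumsmx_sup (Ordinal lt_r)) //; apply/(@Hcentre (Ordinal lt_r) (leqnn r)).
  by split=> // x; apply: Jc.
case/eqP: nz; apply: (k_anisotropic sum_kk_ideal.1) => //.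
by have /perpP := submx_trans nzJ Jp; apply.
Qed.

Lemma k_sub_sum : (k <= S)%MS.
Proof.
have S'0 := ideal_perp_sum0 (ideal_perp sum_kk_ideal) (capmxSr _ _).
apply/rV_subP => x xk; have [y yS] := ideal_decomp sum_kk_ideal xk.
by rewrite S'0 submx0 subr_eq0 => /eqP ->.
Qed.

Local Notation p := (perp c k).
Hypothesis Hpp : br_sub c p p k.
Hypothesis Hp_pos : forall x, (x <= p)%MS -> x != 0 -> 0 < killing c x x.

Lemma br_kp x y : (x <= k)%MS -> (y <= p)%MS -> (br x y <= p)%MS.
Proof.
move=> xk /perpP yp; apply/perpP => w wk.
by rewrite (bracketC lie_c) mxformNl (killing_inv lie_c) yp ?oppr0 // k_sub.
Qed.

Lemma cartan_split_exists : exists P Pi, [/\ cartan_split c P Pi,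
  orthprojmx G p P, forall i, orthprojmx G (kk i) (Pi i) &
  orthprojmx G k (\sum_i Pi i)].
Proof.
have exPi i : exists F, orthprojmx G (kk i) F.
  exact: orthprojmx_exists (kgram_sym c) (k_anisotropic (kk_sub i)).
have [Pi PiE] := fin_all_exists exPi.
have Pi_sub m i (x : 'M_(m, N)) : (x *m Pi i <= kk i)%MS := orthprojmx_sub x (PiE i).
have Pi_id m i (x : 'M_(m, N)) : (x <= kk i)%MS -> x *m Pi i = x := orthprojmx_id (PiE i).
have Pi_adj i x y : B (x *m Pi i) y = B x (y *m Pi i) := orthprojmx_adj x y (PiE i).
have PiPi i : Pi i *m Pi i = Pi i by rewrite Pi_id // -[Pi i]mul1mx.
have orth i j : i != j -> Pi i *m Pi j = 0.
  move=> ij; apply/row_matrixP => l; rewrite row_mul row0.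
  apply: (k_anisotropic (kk_sub j)) => //; rewrite Pi_adj -mulmxA PiPi.
  by rewrite (kk_orth ij) // rowE.
have KG : (\sum_i Pi i) *m G = G *m (\sum_i Pi i)^T.
  rewrite mulmx_suml linear_sum mulmx_sumr; apply: eq_bigr => i _.
  by case: (PiE i).
have kK m (x : 'M_(m, N)) : (x <= k)%MS -> x *m (\sum_i Pi i) = x.
  move=> /submx_trans/(_ k_sub_sum) /sub_sumsmxP [u ->].
  rewrite mulmx_suml; apply: eq_bigr => i _.
  rewrite mulmx_sumr (bigD1 i) //= Pi_id ?submxMl // big1 ?addr0 // => j ji.
  by rewrite -(Pi_id _ i (u i *m kk i)) ?submxMl // -mulmxA orth ?mulmx0 // eq_sym.
have Kk : ((\sum_i Pi i)%R <= k)%MS.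
  rewrite summx_sub // => i _; rewrite -[Pi i]mul1mx.
  exact: submx_trans (Pi_sub _ _ _) (kk_sub i).
have KE : orthprojmx G k (\sum_i Pi i) by split=> //; apply: kK.
set P := 1%:M - \sum_i Pi i.
have PG : P *m G = G *m P^T.
  by rewrite /P linearB /= mulmxBl mulmxBr mul1mx trmx1 mulmx1 KG.
have Pp m (x : 'M_(m, N)) : (x *m P <= p)%MS.
  apply/row_subP => l; rewrite row_mul; apply/perpP => y yk.
  rewrite (adjoint_form _ _ PG) mulmxBr mulmx1 kK // subrr.
  by rewrite mxform0r.
have kP m (x : 'M_(m, N)) : (x <= k)%MS -> x *m P = 0.
  by move=> xk; rewrite mulmxBr mulmx1 kK // subrr.
have pPi m i (x : 'M_(m, N)) : (x <= p)%MS -> x *m Pi i = 0.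
  move=> xp; apply/row_matrixP => l; rewrite row_mul row0.
  apply: (k_anisotropic (kk_sub i)) => //; rewrite Pi_adj -mulmxA PiPi.
  have /perpP -> // : (row l x <= p)%MS by apply: submx_trans (row_sub _ _) xp.
  exact: submx_trans (Pi_sub _ _ _) (kk_sub i).
have pP m (x : 'M_(m, N)) : (x <= p)%MS -> x *m P = x.
  by move=> xp; rewrite mulmxBr mulmx1 mulmx_sumr big1 ?subr0 // => i _; apply: pPi.
have Pik m i (x : 'M_(m, N)) : (x *m Pi i <= k)%MS.
  exact: submx_trans (Pi_sub _ _ _) (kk_sub i).
exists P, Pi; split=> //; last first.
  by split=> //; [rewrite -[P]mul1mx|apply: pP].
split=> //.
- by rewrite subrK.
- by move=> i; rewrite pPi // -[P]mul1mx.
- by move=> i; rewrite kP // -[Pi i]mul1mx.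
- by move=> i; case: (PiE i).
- by move=> i j x y ij; apply: (kk_commute ij).
- move=> i x y; apply: Pi_id; apply: (kk_ideal i).2 => //.
- by move=> i x y; apply: pP; apply: br_kp.
- by move=> x y; apply: kP; apply: Hpp.
- by move=> x x0; rewrite -killingE Hp_pos.
- by move=> i x x0; rewrite -killingE k_neg.
Qed.

End Ideals.
End Compact.

(** * Q and the metrics of M_K expressed through B and the projections *)

Section Tensors.
Context {R : realType} {N q : nat} (c : 'I_N -> 'I_N -> 'rV[R]_N) (k : 'M[R]_N).
Hypothesis lie_c : is_lie_algebra c.
Hypothesis k_neg : forall x, (x <= k)%MS -> x != 0 -> killing c x x < 0.
Variables (P : 'M[R]_N) (Pi kk : 'I_q -> 'M[R]_N).
Local Notation G := (kgram c).
Local Notation B := (mxform G).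
Local Notation p := (perp c k).
Local Notation K := (kproj Pi).
Hypotheses (CS : cartan_split c P Pi) (PE : orthprojmx G p P)
  (PiU : forall i, orthprojmx G (kk i) (Pi i)) (KE : orthprojmx G k K).
Hypothesis kk_ideal : forall i, ideal_of c (kk i) k.
Implicit Types x y : 'rV[R]_N.

Lemma cap_pk : (p :&: k)%MS = 0.
Proof. by rewrite capmxC; apply: anisotropic_cap; apply: k_anisotropic k_neg _ _. Qed.

Lemma proj_kp : proj_mx k p = K.
Proof. by apply: orthprojmx_proj => //; apply: k_anisotropic k_neg _ _. Qed.

Lemma proj_pk : proj_mx p k = P.
Proof.
rewrite -[LHS]mul1mx -(cs_one CS) mulmxDl proj_mx_id ?cap_pk //; last by case: PE.
by rewrite proj_mx_0 ?cap_pk ?addr0 //; case: KE.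
Qed.

Lemma QformE x y : Qform c k x y = mxform ((P - K) *m G) x y.
Proof.
rewrite /Qform proj_kp proj_pk !killingE.
transitivity (B (x *m (P - K)) y); last by rewrite /mxform !mulmxA.
rewrite mulmxBr mxformDl mxformNl.
by rewrite !(adjoint_form _ _ (P_adj CS), adjoint_form _ _ (kproj_adj CS))
  -!mulmxA (P_idem CS) (kproj_idem CS).
Qed.

Lemma gram_Qform : gram_of (Qform c k) = (P - K) *m G.
Proof. by apply/matrixP => i j; rewrite mxE QformE mxform_ev. Qed.

Lemma posdef_Q : posdefmx ((P - K) *m G).
Proof. by rewrite kprojE; apply: (posdef_metric CS). Qed.

(** Commuting with P - K makes the B-orthogonal projection [F] self-adjoint for Q as well, so it is
    also the Q-orthogonal one. *)
Lemma QrestrE (U F : 'M[R]_N) x y : orthprojmx G U F -> F *m (P - K) = (P - K) *m F ->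
  Qrestr c k U x y = Qform c k (x *m F) (y *m F).
Proof.
move=> FE comm; rewrite /Qrestr gram_Qform (@orthprojmx_proj _ _ _ _ F) //.
  move=> z _ Qz; apply/eqP/negPn/negP => /posdef_Q.2.
  by rewrite Qz ltxx.
case: FE => FU UF FG; split=> //.
by rewrite mulmxA comm -!mulmxA FG.
Qed.

Lemma Qrestr_p x y : Qrestr c k p x y = B (x *m P) (y *m P).
Proof.
rewrite (QrestrE _ _ PE); last first.
  by rewrite mulmxBr mulmxBl (P_kproj CS) (kproj_P CS).
rewrite QformE; transitivity (B (x *m P *m (P - K)) (y *m P)).
  by rewrite /mxform !mulmxA.
by rewrite -mulmxA mulmxBr (P_idem CS) (P_kproj CS) subr0.
Qed.

Lemma Qrestr_kk i x y : Qrestr c k (kk i) x y = - B (x *m Pi i) (y *m Pi i).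
Proof.
rewrite (QrestrE _ _ (PiU i)); last first.
  rewrite mulmxBr mulmxBl (cs_PPi CS) (cs_PiP CS).
  by rewrite (kproj_Pi CS) (Pi_kproj CS).
rewrite QformE; transitivity (B (x *m Pi i *m (P - K)) (y *m Pi i)).
  by rewrite /mxform !mulmxA.
rewrite -mulmxA mulmxBr (cs_PiP CS) (Pi_kproj CS) sub0r mulmxN.
by rewrite mxformNl.
Qed.

(** The factor [1 *] keeps the literal shape of [inMK] with beta = 1. *)
Definition metric_of (a : 'I_q -> R) x y :=
  1 * Qrestr c k p x y + \sum_i a i * Qrestr c k (kk i) x y.

Lemma metric_ofE a x y : metric_of a x y = B (x *m (P - wproj Pi a)) y.
Proof.
rewrite /metric_of mul1r Qrestr_p mulmxBr mxformDl mxformNl; congr (_ + _).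
  by rewrite (adjoint_form _ _ (P_adj CS)) -mulmxA (P_idem CS)
    (adjoint_form _ _ (P_adj CS)).
rewrite /wproj mulmx_sumr mxform_suml -sumrN; apply: eq_bigr => i _.
rewrite Qrestr_kk -scalemxAr mxformZl mulrN (adjoint_form _ _ (cs_adj CS i)).
by rewrite -mulmxA (cs_idem CS) (adjoint_form _ _ (cs_adj CS i)).
Qed.

(** All these metrics agree on p, which forces the homothety factor to be 1. *)
Lemma metric_of_homothetic a b : P != 0 -> (forall i, Pi i != 0) ->
  homothetic (metric_of a) (metric_of b) -> a =1 b.
Proof.
have nz (M : 'M[R]_N) : M != 0 -> exists x, x *m M != 0.
  by move=> /row_neq0 [l lM]; exists (ev R l); rewrite -rowE.
move=> /nz [x xP] Pi0 [lam [lam0 h]] i.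
have mP d : metric_of d (x *m P) (x *m P) = B (x *m P) (x *m P).
  rewrite metric_ofE -mulmxA mulmxBr (P_idem CS) (P_wproj CS) subr0.
  by [].
have lam1 : lam = 1.
  have := h (x *m P) (x *m P); rewrite !mP => /eqP.
  rewrite -subr_eq0 -{1}[B _ _]mul1r -mulrBl mulf_eq0 (gt_eqF (cs_pos CS xP)) orbF.
  by rewrite subr_eq0 eq_sym => /eqP.
have [z zi] := nz _ (Pi0 i).
have mPi d : metric_of d (z *m Pi i) (z *m Pi i) = - d i * B (z *m Pi i) (z *m Pi i).
  rewrite metric_ofE -mulmxA mulmxBr (cs_PiP CS) sub0r.
  by rewrite (Pi_wproj CS) mulmxN -scalemxAr mxformNl mxformZl mulNr.
have := h (z *m Pi i) (z *m Pi i); rewrite !mPi lam1 mul1r.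
by move/(mulIf (ltr0_neq0 (cs_neg CS zi)))/oppr_inj.
Qed.

Lemma tr_P : \tr P = (\rank p)%:R.
Proof. by case: PE => ? ? _; apply: tr_proj. Qed.

Lemma tr_Pi i : \tr (Pi i) = (\rank (kk i))%:R.
Proof. by case: (PiU i) => ? ? _; apply: tr_proj. Qed.

Lemma rank_k : (\rank k)%:R = \sum_i (\rank (kk i))%:R :> R.
Proof.
case: KE => Kk kK _; rewrite -(tr_proj Kk kK) linear_sum.
by apply: eq_bigr => i _; apply: tr_Pi.
Qed.

Lemma killing_on_kk i x y : (x <= kk i)%MS -> (y <= kk i)%MS ->
  killing_on c (kk i) x y = \tr (Pi i *m adm c x *m adm c y).
Proof.
move=> xi yi; have stab z : (z <= kk i)%MS -> (kk i *m adm c z <= kk i)%MS.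
  move=> zi; apply/row_subP => l; rewrite row_mul mul_adm (kk_ideal i).2 ?row_sub //.
  exact: submx_trans zi (kk_ideal i).1.
case: (PiU i) => ? ? _; rewrite /killing_on (restr_tr_proj (P := Pi i)) // ?mulmxA //.
by rewrite (submx_trans (submxMr _ (stab x xi))) // stab.
Qed.

End Tensors.

Section Analysis.
Import numFieldNormedType.Exports.
Context {R : realType}.

Lemma ivt_root (f : R -> R) a b : a <= b -> {in `[a, b], continuous f} ->
  f a * f b <= 0 -> exists2 x, a <= x <= b & f x = 0.
Proof.
move=> ab cf fab; have [||x] := @IVT R f a b 0 ab.
- by apply: continuous_in_subspaceT => x; rewrite inE => xab; apply: cf.
- by rewrite minElt maxElt; case: ltP => h; nra.
by rewrite in_itv => xab fx; exists x.
Qed.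

Lemma continuous_sum (I : Type) (s : seq I) (f : I -> R -> R) x :
  (forall i, {for x, continuous (f i)}) ->
  {for x, continuous (fun t => \sum_(i <- s) f i t)}.
Proof.
move=> cf; elim: s => [|i s IHs].
  rewrite (_ : (fun t => _) = fun=> 0); first exact: cvg_cst.
  by apply: boolp.funext => t; rewrite big_nil.
rewrite (_ : (fun t => _) = fun t => f i t + \sum_(j <- s) f j t).
  by apply: continuousD; [exact: cf|exact: IHs].
by apply: boolp.funext => t; rewrite big_cons.
Qed.

(** * Real cubics with vanishing discriminant *)

Section Cubic.
Variables a b c d : R.
Let D := 18 * a * b * c * d - 4 * b ^+ 3 * d + b ^+ 2 * c ^+ 2
         - 4 * a * c ^+ 3 - 27 * a ^+ 2 * d ^+ 2.
Let A0 := b ^+ 2 - 3 * a * c.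
Let Rd := (9 * a * d - b * c) / (2 * A0).
Let Rs := (4 * a * b * c - 9 * a ^+ 2 * d - b ^+ 3) / (a * A0).

(** The cubic and its derivative at [Rd] are explicit multiples of [D], so [Rd] is a double root;
    [Rs] is then the remaining root by Vieta. *)
Lemma cubic_double_root t : 0 < a -> D = 0 -> b ^+ 2 != 3 * a * c ->
  a * t ^+ 3 + b * t ^+ 2 + c * t + d = a * (t - Rs) * (t - Rd) ^+ 2.
Proof.
move=> a0 D0; rewrite -subr_eq0 -/A0 => nA.
have Rs_sum : Rs = - (b / a) - 2 * Rd.
  by rewrite /Rs /Rd /A0; field; rewrite -/A0 nA gt_eqF.
have P' : 3 * a * Rd ^+ 2 + 2 * b * Rd + c = 0.
  have -> : 3 * a * Rd ^+ 2 + 2 * b * Rd + c = - (9 * a * D) / (4 * A0 ^+ 2).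
    by rewrite /Rd /D /A0; field.
  by rewrite D0 mulr0 oppr0 mul0r.
have PRd : a * Rd ^+ 3 + b * Rd ^+ 2 + c * Rd + d = 0.
  have -> : a * Rd ^+ 3 + b * Rd ^+ 2 + c * Rd + d =
     - ((27 * a ^+ 2 * d - 9 * a * b * c + 2 * b ^+ 3) * D) / (8 * A0 ^+ 3).
    by rewrite /Rd /D /A0; field.
  by rewrite D0 mulr0 oppr0 mul0r.
move: Rd Rs_sum P' PRd => x -> P' Px.
have -> : d = - (a * x ^+ 3 + b * x ^+ 2 + c * x) by apply/eqP; rewrite -addr_eq0 addrC Px.
have -> : c = - (3 * a * x ^+ 2 + 2 * b * x) by apply/eqP; rewrite -addr_eq0 addrC P'.
by field; rewrite gt_eqF.
Qed.

(** When b^2 = 3 a c, the product - 27 a^2 D is the square of 27 a^2 d - b^3, so D = 0 determines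
    d. *)
Lemma cubic_triple_root t : 0 < a -> D = 0 -> b ^+ 2 = 3 * a * c ->
  a * t ^+ 3 + b * t ^+ 2 + c * t + d = a * (t + b / (3 * a)) ^+ 3.
Proof.
move=> a0 D0 bac; have cE : c = b ^+ 2 / (3 * a).
  by rewrite bac; field; rewrite gt_eqF.
have dE : 27 * a ^+ 2 * d = b ^+ 3.
  apply/eqP; rewrite -subr_eq0 -sqrf_eq0.
  have -> : (27 * a ^+ 2 * d - b ^+ 3) ^+ 2 = - (27 * a ^+ 2) * D.
    by rewrite /D cE; field; rewrite gt_eqF.
  by rewrite D0 mulr0.
have -> : d = b ^+ 3 / (27 * a ^+ 2) by rewrite -dE; field; rewrite gt_eqF.
by rewrite cE; field; rewrite gt_eqF.
Qed.

End Cubic.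

(** * The scalar equation for C: positivity, growth and zeros of [Fsol] *)

Section Equation.
Variables (q : nat) (n Tp : R) (d kappa T : 'I_q -> R).
Hypotheses (n0 : 0 < n) (Tp0 : 0 < Tp) (d0 : forall i, 0 < d i)
  (kappa0 : forall i, 0 <= kappa i) (kappa1 : forall i, kappa i < 1)
  (T0 : forall i, 0 < T i) (trace : \sum_i d i * (1 - kappa i) = n / 2).

(* [beta = 1] and [alpha_i = ysol C i] solve the k_i-components of [Ric = (C / 4) T];
   the p-component is then [Fsol C = 0]. *)
Definition ysol (C : R) i := Num.sqrt ((C * T i - kappa i) / (1 - kappa i)).

Definition Fsol C := 2 * n + 2 * (\sum_i d i * (1 - kappa i) * ysol C i) - n * C * Tp.

Definition admissible C := forall i, kappa i < C * T i.

Lemma one_sub_kappa_gt0 i : 0 < 1 - kappa i. Proof. by rewrite subr_gt0. Qed.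

Lemma ysol_sqr C i : kappa i <= C * T i -> (1 - kappa i) * ysol C i ^+ 2 = C * T i - kappa i.
Proof.
move=> h; rewrite sqr_sqrtr; last by rewrite divr_ge0 ?subr_ge0 // ltW // one_sub_kappa_gt0.
by rewrite mulrC divfK // gt_eqF // one_sub_kappa_gt0.
Qed.

Lemma ysol_gt0 C i : admissible C -> 0 < ysol C i.
Proof. by move=> h; rewrite sqrtr_gt0 divr_gt0 ?subr_gt0. Qed.

Lemma admissible_le C C' : admissible C -> C <= C' -> admissible C'.
Proof.
by move=> h CC' i; apply: lt_le_trans (h i) _; rewrite ler_pM2r.
Qed.

Lemma ysol_continuous i x : {for x, continuous (ysol^~ i)}.
Proof.
change {for x, continuous (Num.sqrt \o (fun C => (C * T i - kappa i) / (1 - kappa i)))}.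
apply: continuous_comp.
  apply: continuousM; last exact: cvg_cst.
  apply: continuousB; last exact: cvg_cst.
  by apply: continuousM; [exact: cvg_id|exact: cvg_cst].
exact: sqrt_continuous.
Qed.

(** [Num.sqrt] is 0 on negative numbers and continuous everywhere, so no admissibility is required
    of [x]. *)
Lemma Fsol_continuous x : {for x, continuous Fsol}.
Proof.
apply: continuousB; last first.
  apply: continuousM; last exact: cvg_cst.
  by apply: continuousM; [exact: cvg_cst|exact: cvg_id].
apply: continuousD; first exact: cvg_cst.
apply: continuousM; first exact: cvg_cst.
apply: continuous_sum => i; apply: continuousM; first exact: cvg_cst.
exact: ysol_continuous.
Qed.

Lemma trace_ge0 i : 0 <= d i * (1 - kappa i).
Proof. by rewrite mulr_ge0 // ltW // one_sub_kappa_gt0. Qed.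

Lemma Fsol_eventually_neg C0 : exists2 C, C0 <= C & Fsol C < 0.
Proof.
(* [e] is the AM-GM parameter, small enough that the resulting multiple of C absorbs at most half of
   n C T_p; the [+ 1] keeps the denominator positive. *)
pose D := \sum_i d i * T i; pose e := n * Tp / (2 * (D + 1)).
have D0 : 0 <= D by apply: sumr_ge0 => i _; rewrite mulr_ge0 // ltW.
have D1 : 0 < D + 1 by lra.
have e0 : 0 < e by rewrite divr_gt0 ?mulr_gt0.
have eD : e * D <= n * Tp / 2.
  have -> : n * Tp / 2 = e * (D + 1) by rewrite /e; field; lra.
  by rewrite ler_pM2l //; lra.
(* The summands ensure in turn C >= C0, kappa_i <= C T_i for all i, and that the remaining n C T_p /
   2 exceeds the constant terms 2 n + n / (2 e). *)
pose C := `|C0| + (\sum_i kappa i / T i) + 2 * (2 * n + n / 2 / e + 1) / (n * Tp).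
have kT i : 0 <= kappa i / T i by rewrite divr_ge0 // ltW.
have tl : 0 < 2 * (2 * n + n / 2 / e + 1) / (n * Tp).
  by rewrite divr_gt0 ?mulr_gt0 // !addr_gt0 // ?mulr_gt0 // ?invr_gt0.
have S0 : 0 <= \sum_i kappa i / T i by apply: sumr_ge0.
have CC0 : C0 <= C by rewrite (le_trans (ler_norm _)) // /C; lra.
exists C => //.
have C1 : 2 * (2 * n + n / 2 / e + 1) <= C * (n * Tp).
  rewrite -ler_pdivrMr ?mulr_gt0 // /C; have := normr_ge0 C0; lra.
have Cpos : 0 <= C by have := normr_ge0 C0; rewrite /C; lra.
have adm i : kappa i <= C * T i.
  rewrite -ler_pdivrMr //; apply: le_trans (_ : \sum_i kappa i / T i <= _).
    by rewrite (bigD1 i) //= lerDl sumr_ge0.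
  by rewrite /C; have := normr_ge0 C0; lra.
(* AM-GM: [2 y <= 1 / e + e y^2] *)
have : 2 * (\sum_i d i * (1 - kappa i) * ysol C i) <= n / 2 / e + e * C * D.
  rewrite -trace mulr_suml !mulr_sumr -big_split /=; apply: ler_sum => i _.
  have := ysol_sqr (adm i); move: (ysol C i) => y yE.
  apply: le_trans (_ : d i * (1 - kappa i) / e + e * (d i * ((1 - kappa i) * y ^+ 2)) <= _).
    have -> : d i * (1 - kappa i) / e + e * (d i * ((1 - kappa i) * y ^+ 2)) =
      2 * (d i * (1 - kappa i) * y) + d i * (1 - kappa i) * e * (y - e^-1) ^+ 2.
      by field; lra.
    by rewrite lerDl mulr_ge0 ?sqr_ge0 // mulr_ge0 ?trace_ge0 // ltW.
  rewrite lerD2l yE -[leRHS]mulrA ler_pM2l // [leRHS]mulrCA ler_pM2l //.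
  by have := kappa0 i; lra.
have h : e * C * D <= C * (n * Tp / 2).
  by rewrite mulrAC mulrC ler_wpM2l.
by rewrite /Fsol; lra.
Qed.

Lemma root_above C0 : admissible C0 -> 0 <= Fsol C0 ->
  exists C, [/\ admissible C, C0 <= C & Fsol C = 0].
Proof.
move=> adm F0; have [C1 C01 F1] := Fsol_eventually_neg C0.
have [|//|C /andP [C0C _] FC] := @ivt_root Fsol _ _ C01.
- by move=> x _; apply: Fsol_continuous.
- by rewrite mulr_ge0_le0 // ltW.
by exists C; split=> //; apply: admissible_le adm C0C.
Qed.

Definition xsol i := d i * T i / (n * Tp).

Lemma xsol_gt0 i : 0 < xsol i.
Proof. by rewrite divr_gt0 // mulr_gt0. Qed.

Lemma ysol_val i t : 0 <= t -> ysol ((kappa i + (1 - kappa i) * t ^+ 2) / T i) i = t.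
Proof.
move=> t0; rewrite /ysol divfK ?gt_eqF // addrC addKr mulrC mulKf ?gt_eqF ?one_sub_kappa_gt0 //.
by rewrite sqrtr_sqr ger0_norm.
Qed.

Lemma ysol_le C C' i : C <= C' -> ysol C i <= ysol C' i.
Proof.
move=> h; apply: ler_wsqrtr; rewrite ler_pM2r ?invr_gt0 ?one_sub_kappa_gt0 // lerD2r.
by rewrite ler_pM2r.
Qed.

(** Intermediate values between two explicit points. At [a], y_m = x_m for the index m maximising
    kappa_i / T_i, so the sum is at least 1; the choice of m makes [a] admissible. At [b], every y_i
    is at least q x_i, so each of the q terms is at most 1 / q. *)
Lemma balanced_exists (i0 : 'I_q) : exists C, admissible C /\ \sum_i xsol i / ysol C i = 1.
Proof.
have [m _ mmax] := @arg_maxP _ _ _ i0 predT (fun i => kappa i / T i) isT.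
pose val i t := (kappa i + (1 - kappa i) * t ^+ 2) / T i.
pose a := val m (xsol m).
have adm : admissible a.
  move=> i; rewrite -ltr_pdivrMr //; apply: le_lt_trans (mmax i isT) _.
  rewrite ltr_pM2r ?invr_gt0 // ltrDl mulr_gt0 ?one_sub_kappa_gt0 //.
  by rewrite exprn_gt0 // xsol_gt0.
have val0 i t : 0 <= val i t.
  apply: divr_ge0; last exact: ltW.
  by apply: addr_ge0 => //; apply: mulr_ge0; [apply/ltW/one_sub_kappa_gt0|apply: sqr_ge0].
pose b := a + \sum_i val i (q%:R * xsol i).
have S0 : 0 <= \sum_i val i (q%:R * xsol i) by apply: sumr_ge0.
have ab : a <= b by rewrite /b; lra.
have q0 : 0 < q%:R :> R by rewrite ltr0n (leq_ltn_trans _ (ltn_ord i0)).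
pose h C := \sum_i xsol i / ysol C i - 1.
have pos C i : a <= C -> 0 < ysol C i.
  by move=> aC; apply: ysol_gt0; apply: admissible_le aC.
have ha : 0 <= h a.
  rewrite /h subr_ge0 (bigD1 m) //= (ysol_val _ (ltW (xsol_gt0 m))).
  rewrite divff ?gt_eqF ?xsol_gt0 // lerDl sumr_ge0 // => i _.
  by apply: divr_ge0; apply: ltW; [apply: xsol_gt0|apply: pos].
have hb : h b <= 0.
  rewrite /h subr_le0.
  have -> : 1 = \sum_(i < q) q%:R^-1 :> R.
    by rewrite sumr_const card_ord -[RHS]mulr_natr mulVf // gt_eqF.
  apply: ler_sum => i _; rewrite ler_pdivrMr ?pos // mulrC ler_pdivlMr //.
  rewrite mulrC -[leLHS](@ysol_val i); last by apply: mulr_ge0 => //; apply/ltW/xsol_gt0.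
  apply: ysol_le; rewrite /b -/(val i _) (bigD1 i) //=.
  have : 0 <= a by apply: val0.
  have : 0 <= \sum_(j | j != i) val j (q%:R * xsol j) by apply: sumr_ge0.
  by lra.
have [||C /andP [aC _] hC] := @ivt_root h _ _ ab.
- move=> x; rewrite in_itv => /andP [ax _].
  apply: continuousB; last exact: cvg_cst.
  apply: continuous_sum => i; apply: continuousM; first exact: cvg_cst.
  by apply: continuousV; [rewrite gt_eqF // pos|exact: ysol_continuous].
- by rewrite mulr_ge0_le0.
exists C; split; first exact: admissible_le aC.
by move/eqP: hC; rewrite subr_eq0 => /eqP.
Qed.

(** Multiplying n C T_p by the sum, which equals 1, and using C T_i = kappa_i + (1 - kappa_i) y_i^2
    distributes the linear term over the k_i. *)
Lemma Fsol_balanced C : admissible C -> \sum_i xsol i / ysol C i = 1 ->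
  Fsol C = 2 * n + \sum_i d i * ((1 - kappa i) * ysol C i - kappa i / ysol C i).
Proof.
move=> adm bal.
have e : n * C * Tp = \sum_i d i * (kappa i / ysol C i + (1 - kappa i) * ysol C i).
  transitivity (n * C * Tp * \sum_i xsol i / ysol C i); first by rewrite bal mulr1.
  rewrite mulr_sumr; apply: eq_bigr => i _.
  have y0 : ysol C i != 0 by rewrite gt_eqF // ysol_gt0.
  have -> : kappa i / ysol C i + (1 - kappa i) * ysol C i = C * T i / ysol C i.
    have := ysol_sqr (ltW (adm i)); move: (ysol C i) y0 => y y0 yE.
    have -> : C * T i = kappa i + (1 - kappa i) * y ^+ 2 by rewrite yE; ring.
    by field.
  rewrite /xsol; field; by rewrite y0 !gt_eqF.
rewrite /Fsol e mulr_sumr -addrA -sumrB; congr (_ + _).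
by apply: eq_bigr => i _; ring.
Qed.

Lemma xsol_le_ysol C i : admissible C -> \sum_i xsol i / ysol C i = 1 ->
  xsol i <= ysol C i.
Proof.
move=> adm bal; rewrite -[leRHS]mul1r -ler_pdivrMr ?ysol_gt0 // -[leRHS]bal (bigD1 i) //=.
by rewrite lerDl sumr_ge0 // => j _; rewrite divr_ge0 // ltW ?xsol_gt0 ?ysol_gt0.
Qed.

Definition conditionA := \sum_i ((n ^+ 2 * kappa i * Tp ^+ 2 - d i ^+ 2 * (1 - kappa i) * T i ^+ 2)
         / (n * Tp * T i)) - 2 * n < 0.

(** (A) says that the right side of [Fsol_balanced] is positive once y_i is replaced by x_i, and s
    -> (1 - kappa_i) s - kappa_i / s is nondecreasing for s > 0. *)
Lemma conditionA_balanced C : conditionA -> admissible C ->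
  \sum_i xsol i / ysol C i = 1 -> 0 < Fsol C.
Proof.
rewrite /conditionA => A adm bal; rewrite Fsol_balanced //.
have : \sum_i - ((n ^+ 2 * kappa i * Tp ^+ 2 - d i ^+ 2 * (1 - kappa i) * T i ^+ 2)
         / (n * Tp * T i))
   <= \sum_i d i * ((1 - kappa i) * ysol C i - kappa i / ysol C i).
  apply: ler_sum => i _.
  have -> : - ((n ^+ 2 * kappa i * Tp ^+ 2 - d i ^+ 2 * (1 - kappa i) * T i ^+ 2)
         / (n * Tp * T i)) = d i * ((1 - kappa i) * xsol i - kappa i / xsol i).
    rewrite /xsol; field; have := d0 i; have := T0 i => ? ?.
    by rewrite !gt_eqF.
  rewrite ler_pM2l // lerB //; first by rewrite ler_pM2l ?one_sub_kappa_gt0 // xsol_le_ysol.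
  rewrite ler_wpM2l // lef_pV2 ?posrE ?xsol_gt0 ?ysol_gt0 //.
  exact: xsol_le_ysol.
by rewrite sumrN; lra.
Qed.

Lemma one_root (i0 : 'I_q) : conditionA -> exists2 C, admissible C & Fsol C = 0.
Proof.
move=> A; have [C0 [adm bal]] := balanced_exists i0.
have [C [admC _ FC]] := root_above adm (ltW (conditionA_balanced A adm bal)).
by exists C.
Qed.

Lemma two_roots (m : 'I_q) : conditionA ->
  (forall i, kappa i / T i <= kappa m / T m) ->
  kappa m * (- (n * Tp) + \sum_i d i * T i) / T m
    < \sum_i d i + d m * (1 - kappa m) - 3 * n ->
  exists C1 C2, [/\ admissible C1 /\ Fsol C1 = 0, admissible C2 /\ Fsol C2 = 0 & C1 < C2].
Proof.
move=> A mmax condB; have [C0 [adm bal]] := balanced_exists m.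
have F0 := conditionA_balanced A adm bal.
have [C2 [adm2 C02 F2]] := root_above adm (ltW F0).
pose M := kappa m / T m.
have kM i : kappa i <= M * T i by rewrite -ler_pdivrMr.
have ym : ysol M m = 0 by rewrite /ysol /M divfK ?gt_eqF // subrr mul0r sqrtr0.
have FM : Fsol M < 0.
  pose w i := d i * (1 - kappa i).
  have w0 i : 0 <= w i by apply: trace_ge0.
  have eT : M * (- (n * Tp) + \sum_i d i * T i) =
      - (n * M * Tp) + \sum_i d i - \sum_i w i + \sum_i w i * ysol M i ^+ 2.
    rewrite mulrC mulrDl mulr_suml.
    have -> : \sum_i d i * T i * M = \sum_i d i - \sum_i w i + \sum_i w i * ysol M i ^+ 2.
      rewrite -sumrB -big_split; apply: eq_bigr => i _ /=.
      have -> : w i * ysol M i ^+ 2 = d i * (M * T i - kappa i).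
        by rewrite /w -mulrA (ysol_sqr (kM i)).
      by rewrite /w; ring.
    by ring.
  (* Termwise 1 + 2 y - y^2 <= 2, which is (y - 1)^2 >= 0. Since y_m = 0 at [M], the m-th term is
     only w_m instead of 2 w_m; this gain is the term d_m (1 - kappa_m) of (B). *)
  have sq : \sum_i w i * ((1 + 2 * ysol M i) - ysol M i ^+ 2) <= n - w m.
    have -> : n - w m = \sum_i w i * 2 - w m by rewrite -mulr_suml trace; field.
    rewrite (bigD1 m) //= [in leRHS](bigD1 m) //= ym.
    have : \sum_(i | i != m) w i * (1 + 2 * ysol M i - ysol M i ^+ 2)
           <= \sum_(i | i != m) w i * 2.
      apply: ler_sum => i _; rewrite ler_wpM2l //.
      by have := sqr_ge0 (ysol M i - 1); lra.
    by lra.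
  have e : \sum_i w i * ((1 + 2 * ysol M i) - ysol M i ^+ 2) =
    \sum_i w i + 2 * (\sum_i w i * ysol M i) - \sum_i w i * ysol M i ^+ 2.
    rewrite mulr_sumr -sumrN -!big_split; apply: eq_bigr => i _ /=.
    by ring.
  have cB : M * (- (n * Tp) + \sum_i d i * T i) < \sum_i d i + w m - 3 * n.
    by rewrite /M mulrAC.
  rewrite /Fsol; have := trace; rewrite -/w => tr.
  move: cB; rewrite eT e in sq *; rewrite -[\sum_i d i * _ * _]/(\sum_i w i * ysol M i).
  by lra.
have MC0 : M <= C0.
  by rewrite ler_pdivrMr // ltW.
have [|//|C1 /andP [MC1 C10] F1] := @ivt_root Fsol _ _ MC0.
- by move=> x _; apply: Fsol_continuous.
- by rewrite mulr_le0_ge0 // ltW.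
have ltM : M < C1 by rewrite lt_neqAle MC1 andbT; apply: contraTneq FM => ->; rewrite F1 ltxx.
exists C1, C2; split=> //.
  split=> // i; apply: le_lt_trans (kM i) _; by rewrite ltr_pM2r.
apply: lt_le_trans C02; rewrite lt_neqAle C10 andbT.
by apply: contraTneq F0 => <-; rewrite F1 ltxx.
Qed.

(** With two summands the balance equation x_1 / u + x_2 / t = 1 eliminates u = y_1. Then F becomes
    a rational function of t = y_2 alone, whose denominator is positive because t > x_2. *)
Lemma part3_root (i1 i2 : 'I_q) : i1 != i2 -> (forall i, (i == i1) || (i == i2)) ->
  part3_cond n (d i1) (d i2) (kappa i1) (kappa i2) Tp (T i1) (T i2) ->
  exists2 C, admissible C & Fsol C = 0.
Proof.
move=> i12 all12; have [C0 [adm bal]] := balanced_exists i1.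
have sum2 (f : 'I_q -> R) : \sum_i f i = f i1 + f i2.
  rewrite (bigD1 i1) //= (bigD1 i2) /=; last by rewrite eq_sym.
  rewrite big1 ?addr0 // => i /andP [h1 h2].
  by have := all12 i; rewrite (negPf h1) (negPf h2).
suff : part3_cond n (d i1) (d i2) (kappa i1) (kappa i2) Tp (T i1) (T i2) -> 0 <= Fsol C0.
  move=> h /h F0; have [C [admC _ FC]] := root_above adm F0.
  by exists C.
rewrite Fsol_balanced // sum2.
have := ysol_gt0 i1 adm; have := ysol_gt0 i2 adm; move: bal; rewrite sum2 /part3_cond /=.
move: (ysol C0 i1) (ysol C0 i2) => u t.
rewrite /xsol.
have := (d0 i1, d0 i2, T0 i1, T0 i2, kappa0 i1, kappa0 i2, kappa1 i1, kappa1 i2).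
move: (d i1) (d i2) (T i1) (T i2) (kappa i1) (kappa i2) => d1 d2 T1 T2 l1 l2.
move=> [] [] [] [] [] [] [] d1p d2p T1p T2p l1p l2p l1q l2q bal t0 u0.
set a := n * d2 * (1 - l2) * Tp.
set b := d1 ^+ 2 * (1 - l1) * T1 - _ + _ - _.
set c3 := - (2%:R * n * d2 * T2) + _ - _.
set e := - (d2 ^+ 2 * l1 * T2 ^+ 2 / T1) + _.
set x := d2 * T2 / (n * Tp) in bal *.
move=> [D0 cases].
have x0 : 0 < x by rewrite divr_gt0 ?mulr_gt0.
have a0 : 0 < a by rewrite !mulr_gt0 ?subr_gt0.
have x1 : 0 < d1 * T1 / (n * Tp) by rewrite divr_gt0 ?mulr_gt0.
have xt : x < t.
  rewrite -[ltRHS]mul1r -ltr_pdivrMr // -[ltRHS]bal ltrDr.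
  by rewrite divr_gt0.
have tx0 : 0 < t - x by rewrite subr_gt0.
pose P s := a * s ^+ 3 + b * s ^+ 2 + c3 * s + e.
have Px : 0 < P x.
  have -> : P x = d1 ^+ 2 * (1 - l1) * T1 * x ^+ 2.
    rewrite /P /a /b /c3 /e /x; field; rewrite !gt_eqF //.
  by rewrite mulr_gt0 ?exprn_gt0 // mulr_gt0 // mulr_gt0 ?exprn_gt0 ?subr_gt0.
have uE : u = d1 * T1 / (n * Tp) * t / (t - x).
  have h : d1 * T1 / (n * Tp) * t = u * (t - x).
    move: bal; set x1' := d1 * T1 / _ => bal.
    have -> : u * (t - x) = u * t * (x1' / u + x / t) - u * x by rewrite bal; ring.
    by field; rewrite !gt_eqF.
  by rewrite h mulfK // gt_eqF.
have PE : 2 * n + (d1 * ((1 - l1) * u - l1 / u) + d2 * ((1 - l2) * t - l2 / t))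
   = P t / (t * (t - x) * (n * Tp)).
  rewrite uE /P /a /b /c3 /e.
  move: tx0; rewrite /x => tx0.
  have h : t * (n * Tp) - d2 * T2 != 0.
    have -> : t * (n * Tp) - d2 * T2 = (t - d2 * T2 / (n * Tp)) * (n * Tp).
      by field; rewrite !gt_eqF.
    by rewrite gt_eqF // !mulr_gt0.
  field.
  by rewrite h !gt_eqF.
rewrite PE; apply: divr_ge0; last by rewrite ltW // !mulr_gt0.
case: cases => [[bac xR]|[bac [sx xd]]|[bac [xs sd]]|[bac [xd ds]]].
(* In cases (i), (iii), (iv) the cubic would be nonpositive at [x], against [Px]. *)
- have := cubic_triple_root x a0 D0 bac; rewrite -/(P x) => Pxe.
  suff : P x < 0 by move/(lt_trans Px); rewrite ltxx.
  rewrite Pxe pmulr_rlt0 // exprn_odd_lt0 //.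
  by move: xR; lra.
- have := cubic_double_root t a0 D0 bac; rewrite -/(P t) => ->.
  by rewrite mulr_ge0 ?sqr_ge0 // mulr_ge0 ?(ltW a0) // subr_ge0; lra.
- have := cubic_double_root x a0 D0 bac; rewrite -/(P x) => Pxe.
  suff : P x <= 0 by move/(lt_le_trans Px); rewrite ltxx.
  by rewrite Pxe mulr_le0_ge0 ?sqr_ge0 // pmulr_rle0 // subr_le0 ltW.
- have := cubic_double_root x a0 D0 bac; rewrite -/(P x) => Pxe.
  suff : P x <= 0 by move/(lt_le_trans Px); rewrite ltxx.
  by rewrite Pxe mulr_le0_ge0 ?sqr_ge0 // pmulr_rle0 // subr_le0 ltW // (lt_trans xd ds).
Qed.

End Equation.
End Analysis.

Theorem theorem5p10
  (R : realType) (N : nat) (c : 'I_N -> 'I_N -> 'rV[R]_N) (k : 'M[R]_N)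
  (r s : nat) (kk : 'I_(r + s) -> 'M[R]_N) (kappa : 'I_(r + s) -> R)
  (* g is a real simple Lie algebra *)
  (Hlie : is_lie_algebra c)
  (Hsimple : simple_lie c 1%:M)
  (* non-compact: the Killing form is not negative definite *)
  (Hnoncpt : exists x : 'rV[R]_N, x != 0 /\ 0 <= killing c x x)
  (* k = Lie(K), K maximal compact: g = k + p is a Cartan decomposition *)
  (Hk_sub : subalgebra c k)
  (Hpp : br_sub c (perp c k) (perp c k) k)
  (Hk_neg : forall x, (x <= k)%MS -> x != 0 -> killing c x x < 0)
  (Hp_pos : forall x, (x <= perp c k)%MS -> x != 0 -> 0 < killing c x x)
  (* k_1, ..., k_r : the simple ideals of [k,k] (listed without repetition) *)
  (Hkk_simple : forall i : 'I_(r + s), (i < r)%N ->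
      simple_lie c (kk i) /\ ideal_of c (kk i) (derived c k))
  (Hkk_inj : forall i j : 'I_(r + s), (i < r)%N -> (j < r)%N ->
      (kk i == kk j)%MS -> i = j)
  (Hkk_all : forall I : 'M[R]_N, simple_lie c I -> ideal_of c I (derived c k) ->
      exists i : 'I_(r + s), (i < r)%N /\ (kk i == I)%MS)
  (* k_{r+1} : the centre of k, present (s = 1) iff it is nontrivial *)
  (Hs : (s <= 1)%N)
  (Hs1 : s = 1%N <-> exists z : 'rV[R]_N, [/\ z != 0, (z <= k)%MS &
            forall x, (x <= k)%MS -> bracket c x z = 0])
  (Hcentre : forall i : 'I_(r + s), (r <= i)%N -> forall z : 'rV[R]_N,
      (z <= kk i)%MS <-> ((z <= k)%MS /\ forall x, (x <= k)%MS -> bracket c x z = 0))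
  (* B_i = kappa_i B|_{k_i} *)
  (Hkappa : forall (i : 'I_(r + s)) (x y : 'rV[R]_N), (x <= kk i)%MS -> (y <= kk i)%MS ->
      killing_on c (kk i) x y = kappa i * killing c x y)
  (Tp : R) (Ti : 'I_(r + s) -> R) (HTp : 0 < Tp) (HTi : forall i, 0 < Ti i) :
  let n : R := (\rank (perp c k))%:R in
  let d (i : 'I_(r + s)) : R := (\rank (kk i))%:R in
  let dimk : R := (\rank k)%:R in
  let T := tensorT c k kk Tp Ti in
  let trQT := - (n * Tp) + \sum_(i < r + s) d i * Ti i in
  let condA := \sum_(i < r + s)
        ((n ^+ 2 * kappa i * Tp ^+ 2 - d i ^+ 2 * (1 - kappa i) * Ti i ^+ 2)
         / (n * Tp * Ti i)) - 2%:R * n < 0 in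
  let condB := exists m : 'I_(r + s),
        [/\ (m < r)%N,
            (forall i : 'I_(r + s), (i < r)%N -> kappa i / Ti i <= kappa m / Ti m) &
            kappa m * trQT / Ti m < dimk + d m * (1 - kappa m) - 3%:R * n] in
  let einstein_type (g : 'rV[R]_N -> 'rV[R]_N -> R) (cc : R) :=
        [/\ inMK c k kk g, 0 < cc & forall x y, ricci c g x y = cc * T x y] in
  [/\ (condA -> exists g cc, einstein_type g cc),
      (condA -> condB -> exists g1 c1 g2 c2,
          [/\ einstein_type g1 c1, einstein_type g2 c2 & ~ homothetic g1 g2]) &
      (forall i1 i2 : 'I_(r + s), (r + s)%N = 2%N -> val i1 = 0%N -> val i2 = 1%N ->
          part3_cond n (d i1) (d i2) (kappa i1) (kappa i2) Tp (Ti i1) (Ti i2) ->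
          exists g cc, einstein_type g cc)].
Proof.
have [P [Pi [CS PU PiU KU]]] := cartan_split_exists Hlie Hk_sub Hk_neg Hkk_simple
  Hkk_inj Hkk_all Hs Hs1 Hcentre Hpp Hp_pos.
have kk_id := kk_ideal Hlie Hk_sub Hkk_simple Hcentre.
have kkn0 := kk_neq0 Hkk_simple Hs Hs1 Hcentre.
move=> n d dimk T trQT condA condB einstein_type.
have PUid : perp c k *m P = perp c k by case: PU.
(* If p were 0 then g = k, and B would be negative definite, against non-compactness. *)
have n_gt0 : 0 < n.
  rewrite /n ltr0n lt0n mxrank_eq0; apply/eqP => p0.
  have P0 : P = 0.
    by apply/eqP; rewrite -submx0 -p0; case: PU.
  have [x [x0]] := Hnoncpt; rewrite leNgt Hk_neg //.
  rewrite (decomp CS x) P0 mulmx0 add0r mulmx_sub //.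
  by case: KU.
have P_neq0 : P != 0.
  apply/eqP => P0; move: n_gt0; rewrite /n -PUid P0 mulmx0 mxrank0.
  by rewrite ltxx.
have rankP : (0 < \rank P)%N by rewrite lt0n mxrank_eq0.
have Pi_neq0 i : Pi i != 0.
  have [_ e _] := PiU i.
  by apply/eqP => Pi0; have := kkn0 i; rewrite -e Pi0 mulmx0 eqxx.
(* Without any k_i one would have p = g and k = 0, so [p, p] in k would make g abelian. *)
have i0 : 'I_(r + s).
  suff : (0 < r + s)%N by move=> h; exact: Ordinal h.
  rewrite lt0n; apply/eqP => rs0.
  have K0 : kproj Pi = 0 by apply: big1 => i _; have := ltn_ord i; rewrite {2}rs0.
  have P1 : P = 1%:M by rewrite (cs_PE CS) K0 subr0.
  have [_ [[x [y [_ _ /eqP xy]]] _]] := Hsimple; apply: xy.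
  by have := cs_bpp CS x y; rewrite P1 !mulmx1.
have kappaE i x y : \tr (Pi i *m adm c (x *m Pi i) *m adm c (y *m Pi i)) =
    kappa i * mxform (kgram c) (x *m Pi i) (y *m Pi i).
  have sub z : (z *m Pi i <= kk i)%MS := orthprojmx_sub z (PiU i).
  by rewrite -(killing_on_kk PiU kk_id) // Hkappa // killingE.
have kappa0 i : 0 <= kappa i := kappa_ge0 Hlie CS kappaE (Pi_neq0 i).
have kappa1 i : kappa i < 1 := kappa_lt1 Hlie CS Hsimple kappaE P_neq0 (Pi_neq0 i).
have [mu muE mu_tr] := fin_all_exists2 (fun i => mu_exists Hlie CS Hsimple kappaE i rankP).
have {}mu_tr i : mu i * n = (1 - kappa i) * d i.
  by rewrite /n /d -(tr_P PU) -(tr_Pi PiU) mu_tr.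
(* Compare the sum over i of the defining equations of mu_i with [tr_kproj_adP] at a vector with
   nonzero p-component. *)
have sum_mu : \sum_i mu i = 2^-1.
  have [x xP] : exists x : 'rV_N, x *m P != 0.
    have [l lP] := row_neq0 P_neq0.
    by exists (delta_mx 0 l); rewrite -rowE.
  have := tr_kproj_adP Hlie CS x x.
  rewrite {1}/kproj !mulmx_suml linear_sum /= (eq_bigr _ (fun i _ => muE i x x)).
  by rewrite -mulr_suml => /(mulIf (lt0r_neq0 (cs_pos CS xP))).
have trace : \sum_i d i * (1 - kappa i) = n / 2%:R.
  rewrite -sum_mu mulr_sumr; apply: eq_bigr => i _.
  by rewrite mulrC -mu_tr mulrC.
have d0 i : 0 < d i by rewrite ltr0n lt0n mxrank_eq0.
pose g C := metric_of c k kk (ysol kappa Ti C).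
have sol C : admissible kappa Ti C -> Fsol n Tp d kappa Ti C = 0 ->
    einstein_type (g C) (C / 4%:R).
  move=> adm FC; have y0 i := ysol_gt0 kappa1 i adm.
  have gE x y := metric_ofE Hk_neg CS PU PiU KU (ysol kappa Ti C) x y.
  split.
  - by exists 1, (ysol kappa Ti C); split.
  - rewrite divr_gt0 // -(pmulr_lgt0 _ (HTi i0)).
    exact: le_lt_trans (kappa0 i0) (adm i0).
  move=> x y; rewrite (ricci_diagonal Hlie CS kappaE x y y0 gE muE).
  rewrite /T /tensorT (Qrestr_p Hk_neg CS PU KU).
  under [in RHS]eq_bigr => i _ do rewrite (Qrestr_kk Hk_neg CS PU PiU KU).
  have -> : 2^-1 * (\sum_i (2 + ysol kappa Ti C i) * mu i) = C / 4 * Tp.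
    have -> : \sum_i (2 + ysol kappa Ti C i) * mu i
        = 1 + (\sum_i d i * (1 - kappa i) * ysol kappa Ti C i) / n.
      have one : 2 * \sum_i mu i = 1 by rewrite sum_mu mulfV.
      rewrite -[X in _ = X + _]one.
      rewrite mulr_sumr mulr_suml -big_split; apply: eq_bigr => i _ /=.
      have -> : d i * (1 - kappa i) = mu i * n by rewrite mu_tr mulrC.
      by field; rewrite gt_eqF.
    have -> : \sum_i d i * (1 - kappa i) * ysol kappa Ti C i = n * C * Tp / 2 - n.
      by move: FC; rewrite /Fsol; lra.
    by field; rewrite gt_eqF.
  rewrite [RHS]mulrDr opprD; congr (_ + _); first by ring.
  rewrite mulr_sumr -sumrN; apply: eq_bigr => i _.
  rewrite (ysol_sqr kappa1 (ltW (adm i))) mulrN mulrN; congr (- _).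
  by field.
split.
- move=> A; have [C adm FC] := one_root n_gt0 HTp d0 kappa0 kappa1 HTi trace i0 A.
  by exists (g C), (C / 4%:R); apply: sol.
- move=> A [m [mr mmax cB]].
  (* On the centre the Killing form of k_i vanishes, so the maximum of kappa_i / T_i over the simple
     ideals is the maximum over all indices. *)
  have kappa_c (i : 'I_(r + s)) : (r <= i)%N -> kappa i = 0.
    move=> ri; have [l lP] := row_neq0 (Pi_neq0 i).
    have := kappaE i (delta_mx 0 l) (delta_mx 0 l).
    have -> : Pi i *m adm c (delta_mx 0 l *m Pi i) = 0.
      apply/row_matrixP => j; rewrite row_mul mul_adm row0.
      have jk : (row j (Pi i) <= kk i)%MS by rewrite rowE (orthprojmx_sub _ (PiU i)).
      have := (Hcentre _ ri _).1 jk; case=> _; apply.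
      by apply: submx_trans (orthprojmx_sub _ (PiU i)) (kk_id i).1.
    rewrite mul0mx mxtrace0 => /esym/eqP; rewrite mulf_eq0 => /orP [/eqP //|].
    by rewrite lt_eqF // (cs_neg CS) // -rowE.
  have mmax' i : kappa i / Ti i <= kappa m / Ti m.
    have [/mmax //|ri] := ltnP i r.
    by rewrite kappa_c // mul0r divr_ge0 // ltW.
  have cB' : kappa m * (- (n * Tp) + \sum_i d i * Ti i) / Ti m
    < \sum_i d i + d m * (1 - kappa m) - 3 * n.
    by rewrite -(rank_k PiU KU).
  have [C1 [C2 [[adm1 F1] [adm2 F2] C12]]] :=
    two_roots n_gt0 HTp d0 kappa0 kappa1 HTi trace A mmax' cB'.
  exists (g C1), (C1 / 4%:R), (g C2), (C2 / 4%:R); split; [exact: sol|exact: sol|].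
  (* Homothetic metrics have equal alpha_m, and alpha_m determines C because C T_m = kappa_m + (1 -
     kappa_m) alpha_m^2. *)
  move=> /(metric_of_homothetic Hk_neg CS PU PiU KU P_neq0 Pi_neq0) /(_ m) e.
  have := ysol_sqr kappa1 (ltW (adm1 m)); rewrite e (ysol_sqr kappa1 (ltW (adm2 m))).
  move/addIr/(mulIf (lt0r_neq0 (HTi m))) => CC.
  by move: C12; rewrite CC ltxx.
move=> i1 i2 rs2 i1v i2v cond.
have i12 : i1 != i2 by rewrite -val_eqE i1v i2v.
have all12 i : (i == i1) || (i == i2).
  rewrite -!val_eqE i1v i2v /=; have := ltn_ord i; rewrite [X in (_ < X)%N]rs2.
  by case: (nat_of_ord i) => [|[|]].
have [C adm FC] := part3_root n_gt0 HTp d0 kappa0 kappa1 HTi trace i12 all12 cond.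
by exists (g C), (C / 4%:R); apply: sol.
Qed.
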